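(* Let $G$ be a spatial partition quantum group (with fundamental representation $u^\circ$ and associated unitary representation $u^\bullet$) and let $z\in\{\circ,\bullet\}^*$ with $|z|\ge1$. Then $G^z$ is a spatial partition quantum group.
   Context: Colours: $\{\circ,\bullet\}^*$ is the free monoid of finite words in two colours with empty word $1$; $|x|$ is the length and $x_i$ the $i$-th letter of $x$. Spatial partitions: for $m\ge1$, $\mathcal P^{(m)}(x,y)$ is the set of set partitions (into blocks) of $\{1,\dots,|x|+|y|\}\times\{1,\dots,m\}$; points $(i,j)$ with $i\le|x|$ are upper points of colour $x_i$, points $(|x|+i,j)$ are lower points of colour $y_i$, and $j$ is the level. $\mathcal P^{(m)}=\bigcup_{x,y}\mathcal P^{(m)}(x,y)$. Tensor product: place partitions side by side. Involution $p^*\in\mathcal P^{(m)}(y,x)$: swap upper and lower points. Composition $pq\in\mathcal P^{(m)}(x,z)$ of $p\in\mathcal P^{(m)}(y,z)$, $q\in\mathcal P^{(m)}(x,y)$: identify each lower point of $q$ with the corresponding upper point of $p$, merge blocks sharing identified points, delete the identified points and any resulting empty blocks. $\mathrm{id}_x\in\mathcal P^{(m)}(x,x)$ has blocks $\{(i,j),(|x|+i,j)\}$. A category of spatial partitions on $m$ levels is a subset $\mathcal C\subseteq\mathcal P^{(m)}$ closed under composition, tensor product and involution and containing $\mathrm{id}_\circ,\mathrm{id}_\bullet$; $\mathcal C(x,y)=\mathcal C\cap\mathcal P^{(m)}(x,y)$. It is rigid if there are $r\in\mathcal C(1,\circ\bullet)$, $s\in\mathcal C(1,\bullet\circ)$ with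 $(r^*\otimes\mathrm{id}_\circ)(\mathrm{id}_\circ\otimes s)=\mathrm{id}_\circ$ and $(s^*\otimes\mathrm{id}_\bullet)(\mathrm{id}_\bullet\otimes r)=\mathrm{id}_\bullet$. For $\boldsymbol n=(n_1,\dots,n_m)\in\mathbb N^m$, $p$ is $\boldsymbol n$-graded if $n_k=n_\ell$ whenever points $(i,k),(j,\ell)$ lie in one block; a category is $\boldsymbol n$-graded if all its elements are. Quantum groups: for a finite-dimensional Hilbert space $V$ with conjugate $\overline V$, put $V^\circ=V$, $V^\bullet=\overline V$, $V^{\otimes x}=V^{x_1}\otimes\cdots\otimes V^{x_{|x|}}$ ($\mathbb C$ if $x=1$); for an operator $T$, $\overline T(\overline v)=\overline{T(v)}$, $T^\circ=T$, $T^\bullet=\overline T$, $T^{\otimes x}=T^{x_1}\otimes\cdots\otimes T^{x_{|x|}}$. Elements $u\in B(V)\otimes A$ ($A$ a unital $C^*$-algebra) are $A$-valued matrices $(u^i_j)$ in an orthonormal basis; $\overline u\in B(\overline V)\otimes A$ has entries $(u^i_j)^*$; $u\top v$ on $V\otimes W$ has entries $u^{i_1}_{j_1}v^{i_2}_{j_2}$. A compact matrix quantum group is $G=(C(G),u)$ with $C(G)$ a unital $C^*$-algebra generated by the entries of $u\in B(V)\otimes C(G)$, $u$ unitary, $\overline u$ invertible, and a $*$-homomorphism $\Delta:C(G)\to C(G)\otimes C(G)$ with $\Delta(u^i_j)=\sum_k u^i_k\otimes u^k_j$. A representation is an invertible $v\in B(W)\otimes C(G)$ with $\Delta(v^i_j)=\sum_k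 v^i_k\otimes v^k_j$; $\mathrm{Hom}(v,w)=\{T: Tv=wT\}$. Given $u^\circ=u$ and a unitary representation $u^\bullet$ on $\overline V$, $u^x=u^{x_1}\top\cdots\top u^{x_{|x|}}$, $u^1=1$, and for $|z|\ge1$, $G^z=(A,u^z)$ where $A\subseteq C(G)$ is the $C^*$-subalgebra generated by the entries of $u^z$. Linear maps: $[\boldsymbol n]=\prod_k\{1,\dots,n_k\}$, $\mathbb C^{\boldsymbol n}=\mathbb C^{n_1}\otimes\cdots\otimes\mathbb C^{n_m}$ with basis $e_{\boldsymbol i}$, $\boldsymbol i\in[\boldsymbol n]$. For $\boldsymbol n$-graded $p\in\mathcal P^{(m)}(x,y)$, $T_p^{(\boldsymbol n)}:(\mathbb C^{\boldsymbol n})^{\otimes x}\to(\mathbb C^{\boldsymbol n})^{\otimes y}$ has, in the canonical bases, matrix coefficient (input $\boldsymbol j_1,\dots,\boldsymbol j_{|x|}$, output $\boldsymbol i_1,\dots,\boldsymbol i_{|y|}$) equal to $1$ if, labelling upper point $(k,\ell)$ by the $\ell$-th entry of $\boldsymbol j_k$ and lower point $(|x|+k,\ell)$ by the $\ell$-th entry of $\boldsymbol i_k$, labels are constant on every block, and $0$ otherwise. A compact matrix quantum group $G$ with fundamental representation $u^\circ$ on $V$ is a spatial partition quantum group if there are a unitary representation $u^\bullet$ on $\overline V$ (the associated representation), an $\boldsymbol n$-graded rigid category $\mathcal C\subseteq\mathcal P^{(m)}$ (some $m\ge1$, $\boldsymbol n\in\mathbb N^m$) and a unitary $Q:\mathbb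 C^{\boldsymbol n}\to V$ with $\mathrm{Hom}(u^x,u^y)=\mathrm{span}\{Q^{\otimes y}T_p^{(\boldsymbol n)}(Q^{-1})^{\otimes x}:p\in\mathcal C(x,y)\}$ for all $x,y\in\{\circ,\bullet\}^*$. *)

(* Defs.v *)
From HB Require Import structures.
From mathcomp Require Import all_boot all_order all_algebra.

Set Implicit Arguments.
Unset Strict Implicit.
Unset Printing Implicit Defensive.

Import Order.TTheory GRing.Theory Num.Theory.

Local Open Scope ring_scope.

(* White is the colour of V and black the colour of its conjugate. *)
Variant colour := White | Black.

Notation word := (seq colour).

(* A point of a partition in P^(m)(x, y) is a pair of a position and a level;
   the position is [inl i] for the i-th upper point, whose colour is the i-th
   letter of x, and [inr i] for the i-th lower point.  Since an element of
   P^(m) carries its words x and y, a subset of P^(m) is a family of predicates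
   indexed by x and y. *)
Definition point (m : nat) (x y : word) : finType :=
  (('I_(size x) + 'I_(size y)) * 'I_m)%type.

Definition blocks (m : nat) (x y : word) : finType := {set {set point m x y}}.

Definition is_spatial_partition m x y (p : blocks m x y) : bool :=
  partition p [set: point m x y].

Section Operations.
Variable m : nat.

Definition point_left (x y x' y' : word) (a : point m x y) :
    point m (x ++ x') (y ++ y') :=
  (match a.1 with
   | inl i => inl (cast_ord (esym (size_cat x x')) (lshift (size x') i))
   | inr i => inr (cast_ord (esym (size_cat y y')) (lshift (size y') i))
   end, a.2).

Definition point_right (x y x' y' : word) (a : point m x' y') :
    point m (x ++ x') (y ++ y') :=
  (match a.1 with
   | inl i => inl (cast_ord (esym (size_cat x x')) (rshift (size x) i))
   | inr i => inr (cast_ord (esym (size_cat y y')) (rshift (size y) i))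
   end, a.2).

Definition part_tensor x y x' y' (p : blocks m x y) (q : blocks m x' y') :
    blocks m (x ++ x') (y ++ y') :=
  [set (@point_left x y x' y') @: (B : {set _}) | B in p]
  :|: [set (@point_right x y x' y') @: (B : {set _}) | B in q].

Definition point_swap x y (a : point m x y) : point m y x :=
  (match a.1 with inl i => inr i | inr i => inl i end, a.2).

Definition part_inv x y (p : blocks m x y) : blocks m y x :=
  [set (@point_swap x y) @: (B : {set _}) | B in p].

Definition part_id x : blocks m x x :=
  [set [set (inl i.1, i.2); (inr i.1, i.2)] | i : 'I_(size x) * 'I_m].

(* The points of a composition p q before the middle row is deleted: those of
   x, those of y (shared by q and p) and those of z. *)
Definition point3 (x y z : word) : finType :=
  ((('I_(size x) + 'I_(size y)) + 'I_(size z)) * 'I_m)%type.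

Definition point_xy x y z (a : point m x y) : point3 x y z := (inl a.1, a.2).

Definition point_yz x y z (a : point m y z) : point3 x y z :=
  (match a.1 with inl i => inl (inr i) | inr i => inr i end, a.2).

Definition point_xz x y z (a : point m x z) : point3 x y z :=
  (match a.1 with inl i => inl (inl i) | inr i => inr i end, a.2).

Definition part_comp x y z (p : blocks m y z) (q : blocks m x y) :
    blocks m x z :=
  let glued : {set {set point3 x y z}} :=
    [set (@point_xy x y z) @: (B : {set _}) | B in q]
    :|: [set (@point_yz x y z) @: (B : {set _}) | B in p] in
  let touch := [rel a b | [exists B in glued, (a \in B) && (b \in B)]] in
  [set (@point_xz x y z) @^-1: (B : {set _})
    | B in equivalence_partition (connect touch) [set: point3 x y z]]
  :\ set0.

Record category (C : forall x y : word, blocks m x y -> Prop) : Prop := {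
  category_partition : forall x y p, C x y p -> is_spatial_partition p ;
  category_comp : forall x y z p q,
    C y z p -> C x y q -> C x z (part_comp p q) ;
  category_tensor : forall x y x' y' p q,
    C x y p -> C x' y' q -> C (x ++ x') (y ++ y') (part_tensor p q) ;
  category_inv : forall x y p, C x y p -> C y x (part_inv p) ;
  category_id_white : C [:: White] [:: White] (part_id [:: White]) ;
  category_id_black : C [:: Black] [:: Black] (part_id [:: Black])
}.

Definition rigid (C : forall x y : word, blocks m x y -> Prop) : Prop :=
  exists (r : blocks m [::] [:: White; Black])
         (s : blocks m [::] [:: Black; White]),
    [/\ C [::] [:: White; Black] r, C [::] [:: Black; White] s,
        part_comp (part_tensor (part_inv r) (part_id [:: White]))
                  (part_tensor (part_id [:: White]) s)
          = part_id [:: White]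
      & part_comp (part_tensor (part_inv s) (part_id [:: Black]))
                  (part_tensor (part_id [:: Black]) r)
          = part_id [:: Black]].

Variable n : 'I_m -> nat.

Definition graded x y (p : blocks m x y) : Prop :=
  forall (B : {set point m x y}) (a b : point m x y),
    B \in p -> a \in B -> b \in B -> n a.2 = n b.2.

Definition graded_category
    (C : forall x y : word, blocks m x y -> Prop) : Prop :=
  forall x y p, C x y p -> graded p.

(* The index set [n_1] x ... x [n_m], with entries counted from 0. *)
Definition multi_index : finType := {dffun forall l : 'I_m, 'I_(n l)}.

Definition point_label x y (i : {ffun 'I_(size y) -> multi_index})
    (j : {ffun 'I_(size x) -> multi_index}) (a : point m x y) : nat :=
  match a.1 with inl k => j k a.2 | inr k => i k a.2 end.

End Operations.

(* A finite-dimensional Hilbert space V is given by a finite set I indexing an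
   orthonormal basis, the conjugate of V by the same set indexing the conjugate
   basis, and the tensor power of V along a word x by the functions from
   'I_(size x) to I.  The entry of row i and column j of u is [u (i, j)]. *)
Notation imx I J A := {ffun (I * J)%type -> A}.

Section Matrices.
Variable A : pzRingType.

Definition mulm (I J K : finType) (u : imx I J A) (v : imx J K A) : imx I K A :=
  [ffun ik => \sum_(j : J) u (ik.1, j) * v (j, ik.2)].

Definition idm (I : finType) : imx I I A := [ffun ij => (ij.1 == ij.2)%:R].

Definition invertible (I : finType) (u : imx I I A) : Prop :=
  exists v : imx I I A, mulm u v = idm I /\ mulm v u = idm I.

Variable conj : A -> A.

Definition conjm (I J : finType) (u : imx I J A) : imx I J A :=
  [ffun ij => conj (u ij)].

Definition adjm (I J : finType) (u : imx I J A) : imx J I A :=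
  [ffun ji => conj (u (ji.2, ji.1))].

Definition unitarym (I J : finType) (u : imx I J A) : Prop :=
  mulm u (adjm u) = idm I /\ mulm (adjm u) u = idm J.

(* The product is taken in increasing order of k: the entries need not
   commute. *)
Definition word_power (I J : finType) (w : colour -> imx I J A) (x : word) :
    imx {ffun 'I_(size x) -> I} {ffun 'I_(size x) -> J} A :=
  [ffun ij : {ffun 'I_(size x) -> I} * {ffun 'I_(size x) -> J} =>
    \prod_(k < size x) w (nth White x k) (ij.1 k, ij.2 k)].

End Matrices.

Definition colour_case (T : Type) (w b : T) (c : colour) : T :=
  match c with White => w | Black => b end.

Definition part_matrix (A : pzRingType) (m : nat) (n : 'I_m -> nat) x y
    (p : blocks m x y) :
    imx {ffun 'I_(size y) -> multi_index n}
        {ffun 'I_(size x) -> multi_index n} A :=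
  [ffun ij : {ffun 'I_(size y) -> multi_index n}
             * {ffun 'I_(size x) -> multi_index n} =>
    [forall B in p, forall a in B, forall b in B,
     point_label ij.1 ij.2 a == point_label ij.1 ij.2 b]%:R].

From mathcomp Require Import complex.
From mathcomp Require Import all_classical all_reals.
From mathcomp Require Import topology normedtype.

Import numFieldNormedType.Exports.

Local Open Scope classical_set_scope.

(* The complex numbers are R[i] for a realType R, and norms take their values in
   R[i], as for every normed module over a numFieldType in the library.  The
   library hierarchy does not allow a structure to inherit both a ring and a
   norm over another field, so the norm [cnorm] of a C*-algebra A is part of
   the mixin, and [normed A] is A as a normed module of the library, through
   which the topology of A is accessed. *)

HB.mixin Record isPreCStarAlgebra (R : realType) A & GRing.Algebra R[i] A := {
  star : A -> A ;
  cnorm : A -> R[i] ;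
  starK : involutive star ;
  star_semilinear : forall (k : R[i]) (a b : A),
    star (k *: a + b) = k^* *: star a + star b ;
  starM : forall a b : A, star (a * b) = star b * star a ;
  cnormD : forall a b : A, cnorm (a + b) <= cnorm a + cnorm b ;
  cnormZ : forall (k : R[i]) (a : A), cnorm (k *: a) = `|k| * cnorm a ;
  cnorm_eq0 : forall a : A, cnorm a = 0 -> a = 0 ;
  cnormM : forall a b : A, cnorm (a * b) <= cnorm a * cnorm b ;
  cnorm_starM : forall a : A, cnorm (star a * a) = cnorm a ^+ 2
}.

#[short(type="preCstarAlgType")]
HB.structure Definition PreCStarAlgebra (R : realType) :=
  {A of GRing.Algebra R[i] A & isPreCStarAlgebra R A}.

Definition normed (R : realType) (A : preCstarAlgType R) : Type := A.

HB.instance Definition _ (R : realType) (A : preCstarAlgType R) :=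
  GRing.Lmodule.copy (normed A) A.

HB.instance Definition _ (R : realType) (A : preCstarAlgType R) :=
  Lmodule_isNormed.Build R[i] (normed A) (@cnormD R A) (@cnormZ R A)
    (@cnorm_eq0 R A).

HB.mixin Record PreCStarAlgebra_isComplete (R : realType) A
    & PreCStarAlgebra R A := {
  cstar_complete : forall F : set_system (normed A),
    ProperFilter F -> cauchy F -> cvg F
}.

#[short(type="cstarAlgType")]
HB.structure Definition CStarAlgebra (R : realType) :=
  {A of PreCStarAlgebra R A & PreCStarAlgebra_isComplete R A}.

HB.instance Definition _ (R : realType) (A : cstarAlgType R) :=
  Uniform_isComplete.Build (normed A) (@cstar_complete R A).

HB.mixin Record isHilbert (R : realType) H & CompleteNormedModule R[i] H := {
  dot : H -> H -> R[i] ;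
  dotC : forall x y : H, dot y x = (dot x y)^* ;
  dot_linear : forall (k : R[i]) (x y z : H),
    dot (k *: x + y) z = k * dot x z + dot y z ;
  dot_norm : forall x : H, dot x x = `|x| ^+ 2
}.

#[short(type="hilbertType")]
HB.structure Definition Hilbert (R : realType) :=
  {H of CompleteNormedModule R[i] H & isHilbert R H}.

Section CStarSub.
Variables (R : realType) (A : cstarAlgType R).

Definition cstar_closed (S : set A) : Prop :=
  [/\ closed (S : set (normed A)), subalg_closed (mem S)
    & forall a, S a -> S (star a)].

(* The unital C*-subalgebra generated by X. *)
Definition cstar_gen (X : set A) : set A := smallest cstar_closed X.

Lemma cstar_genP X : cstar_closed (cstar_gen X).
Proof.
split.
- by apply: closed_bigI => S [[]].
- split.
  + by apply/mem_set => S [[_ [/set_mem S1 _ _] _] _].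
  + move=> k u v /set_mem hu /set_mem hv; apply/mem_set => S SX.
    have [[_ [_ lS _] _] _] := SX.
    by apply/set_mem/lS; apply/mem_set; [exact: hu|exact: hv].
  + move=> u v /set_mem hu /set_mem hv; apply/mem_set => S SX.
    have [[_ [_ _ mS] _] _] := SX.
    by apply/set_mem/mS; apply/mem_set; [exact: hu|exact: hv].
- by move=> a ha S SX; have [[_ _ sS] _] := SX; apply: sS; exact: ha.
Qed.

Definition cstar_gen_pred (X : set A) : {pred A} := mem (cstar_gen X).

Lemma cstar_gen_predP X a : reflect (cstar_gen X a) (a \in cstar_gen_pred X).
Proof. exact: asboolP. Qed.

HB.instance Definition _ X := GRing.isSubalgClosed.Build _ _ (cstar_gen_pred X)
  (let: And3 _ h _ := cstar_genP X in h).

Variable X : set A.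

Record cstar_sub := CStarSub {
  cstar_val :> A ;
  _ : cstar_val \in cstar_gen_pred X
}.

HB.instance Definition _ := [isSub for cstar_val].
HB.instance Definition _ := [Choice of cstar_sub by <:].
HB.instance Definition _ := [SubChoice_isSubAlgebra of cstar_sub by <:].

Lemma cstar_sub_valP (a : cstar_sub) : cstar_gen X (\val a).
Proof. by case: a => c cX; exact: (elimT (cstar_gen_predP X c) cX). Qed.

Lemma cstar_sub_star (a : cstar_sub) : star (\val a) \in cstar_gen_pred X.
Proof.
have [_ _ sS] := cstar_genP X.
exact: (introT (cstar_gen_predP X _) (sS _ (cstar_sub_valP a))).
Qed.

Let sstar (a : cstar_sub) : cstar_sub := CStarSub (cstar_sub_star a).
Let snorm (a : cstar_sub) : R[i] := cnorm (\val a).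

Let sstarK : involutive sstar.
Proof. by move=> a; apply: val_inj; exact: starK. Qed.

Let sstar_semilinear (k : R[i]) (a b : cstar_sub) :
  sstar (k *: a + b) = k^* *: sstar a + sstar b.
Proof. by apply: val_inj; exact: star_semilinear. Qed.

Let sstarM (a b : cstar_sub) : sstar (a * b) = sstar b * sstar a.
Proof. by apply: val_inj; exact: starM. Qed.

Let snormD (a b : cstar_sub) : snorm (a + b) <= snorm a + snorm b.
Proof. exact: cnormD. Qed.

Let snormZ (k : R[i]) (a : cstar_sub) : snorm (k *: a) = `|k| * snorm a.
Proof. exact: cnormZ. Qed.

Let snorm_eq0 (a : cstar_sub) : snorm a = 0 -> a = 0.
Proof. by move=> /cnorm_eq0 a0; exact: val_inj. Qed.

Let snormM (a b : cstar_sub) : snorm (a * b) <= snorm a * snorm b.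
Proof. exact: cnormM. Qed.

Let snorm_starM (a : cstar_sub) : snorm (sstar a * a) = snorm a ^+ 2.
Proof. exact: cnorm_starM. Qed.

HB.instance Definition _ := isPreCStarAlgebra.Build R cstar_sub sstarK
  sstar_semilinear sstarM snormD snormZ snorm_eq0 snormM snorm_starM.

Let scomplete (F : set_system (normed cstar_sub)) :
  ProperFilter F -> cauchy F -> cvg F.
Proof.
move=> FF cF.
pose f (a : normed cstar_sub) : normed A := \val (a : cstar_sub).
have fN (a b : normed cstar_sub) : `|f a - f b| = `|a - b| by [].
have cfF : cauchy (f @ F).
  apply/cauchy_ballP => e e0.
  have /cauchy_ballP/(_ e e0) := cF.
  rewrite near_simpl => -[[P Q] /= [FP FQ] PQ].
  exists (f @` P, f @` Q) => /=.
    by split; [apply: filterS FP|apply: filterS FQ] => x ?; exists x.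
  move=> [x y] /= [[a Pa <-] [b Qb <-]].
  have := PQ (a, b) (conj Pa Qb).
  by rewrite -!ball_normE /ball_ /= fN.
have [l fl] : exists l : normed A, f @ F --> l.
  by apply/cvg_ex; exact: cstar_complete.
have Sl : l \in cstar_gen_pred X.
  have [cS _ _] := cstar_genP X; apply: (introT (cstar_gen_predP X l)).
  apply: (closed_cvg (cstar_gen X : set (normed A)) cS _ _ fl).
  by apply: nearW => a; exact: cstar_sub_valP.
apply/cvg_ex; exists (CStarSub Sl : normed cstar_sub).
apply/cvgrPdist_lt => e e0.
have /cvgrPdist_lt/(_ e e0) := fl.
by apply: filterS => a.
Qed.

HB.instance Definition _ :=
  PreCStarAlgebra_isComplete.Build R cstar_sub scomplete.

End CStarSub.

Definition lin_span (K : pzRingType) (V : lmodType K) (X : set V) : set V :=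
  [set v | exists s : seq (K * V),
     (forall c, c \in s -> X c.2) /\ v = \sum_(c <- s) c.1 *: c.2].

Section SpatialTensor.
Variable R : realType.

Record star_representation (A : cstarAlgType R) (H : hilbertType R)
    (pi : A -> H -> H) : Prop := {
  rep_operator_linear : forall a, linear (pi a) ;
  rep_operator_continuous : forall a, continuous (pi a) ;
  rep_linear : forall (k : R[i]) (a b : A) (x : H),
    pi (k *: a + b) x = k *: pi a x + pi b x ;
  rep_one : forall x : H, pi 1 x = x ;
  rep_mul : forall (a b : A) (x : H), pi (a * b) x = pi a (pi b x) ;
  rep_star : forall (a : A) (x y : H), dot (pi a x) y = dot x (pi (star a) y)
}.

Definition faithful (A : cstarAlgType R) (H : hilbertType R)
    (pi : A -> H -> H) : Prop :=
  forall a, (forall x, pi a x = 0) -> a = 0.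

(* The norm of T is the operator norm of B(H). *)
Definition isometric (T : cstarAlgType R) (H : hilbertType R)
    (rho : T -> H -> H) : Prop :=
  forall t : T, (forall x, `|rho t x| <= cnorm t * `|x|) /\
    forall c : R[i], 0 <= c -> (forall x, `|rho t x| <= c * `|x|) ->
      cnorm t <= c.

Definition hilbert_tensor (H1 H2 K : hilbertType R) (t : H1 -> H2 -> K) :
    Prop :=
  [/\ forall y, linear (t^~ y), forall x, linear (t x),
      forall x y x' y', dot (t x y) (t x' y') = dot x x' * dot y y'
    & closure (lin_span [set z | exists x y, z = t x y]) = setT].

(* T, with tens a b in the role of the elementary tensor of a and b, is the
   minimal C*-tensor product of A and B: it is realised as the closed span of
   the operators pi1 a (x) pi2 b for faithful representations pi1 and pi2. *)
Definition spatial_tensor (A B T : cstarAlgType R) (tens : A -> B -> T) :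
    Prop :=
  exists (H1 H2 K : hilbertType R) (t : H1 -> H2 -> K)
         (pi1 : A -> H1 -> H1) (pi2 : B -> H2 -> H2) (rho : T -> K -> K),
    [/\ hilbert_tensor t,
        star_representation pi1 /\ faithful pi1,
        star_representation pi2 /\ faithful pi2,
        star_representation rho /\ isometric rho &
        (forall a b x y, rho (tens a b) (t x y) = t (pi1 a x) (pi2 b y)) /\
        closure (lin_span [set z | exists a b, z = tens a b] : set (normed T))
          = setT].

End SpatialTensor.

Section QuantumGroups.
Variable R : realType.

(* The pair (C(G), u); being a compact matrix quantum group is a property of
   it. *)
Record matrix_pair := MatrixPair {
  function_algebra : cstarAlgType R ;
  basis_index : finType ;
  fundamental : imx basis_index basis_index function_algebra
}.

Record comultiplication (A : cstarAlgType R) (I : finType) (u : imx I I A) := {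
  comul_target : cstarAlgType R ;
  comul_tens : A -> A -> comul_target ;
  comul_spatial : spatial_tensor comul_tens ;
  comul : {lrmorphism A -> comul_target} ;
  comul_star : forall a, comul (star a) = star (comul a) ;
  comul_fundamental : forall i j,
    comul (u (i, j)) = \sum_(k : I) comul_tens (u (i, k)) (u (k, j))
}.

Definition compact_matrix_quantum_group (G : matrix_pair) : Prop :=
  [/\ cstar_gen (range (fundamental G)) = setT,
      unitarym (@star R (function_algebra G)) (fundamental G),
      invertible (conjm (@star R (function_algebra G)) (fundamental G))
    & inhabited (comultiplication (fundamental G))].

Definition representation (A : cstarAlgType R) (I : finType) (u : imx I I A)
    (D : comultiplication u) (J : finType) (v : imx J J A) : Prop :=
  invertible v /\ forall i j,
    comul D (v (i, j)) = \sum_(k : J) comul_tens D (v (i, k)) (v (k, j)).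

Definition unitary_representation (A : cstarAlgType R) (I : finType)
    (u : imx I I A) (D : comultiplication u) (J : finType)
    (v : imx J J A) : Prop :=
  representation D v /\ unitarym (@star R A) v.

Definition hom (A : cstarAlgType R) (I J : finType)
    (v : imx I I A) (w : imx J J A) : set (imx J I R[i]^o) :=
  [set T | forall j i, \sum_(k : I) T (j, k) *: v (k, i)
                     = \sum_(k : J) T (k, i) *: w (j, k)].

Definition rep_power (A : cstarAlgType R) (I : finType) (u ublack : imx I I A)
    (x : word) :=
  word_power (colour_case u ublack) x.

(* Q^(y) T_p (Q^-1)^(x) for a unitary Q, whose inverse is its adjoint. *)
Definition part_operator (I : finType) (m : nat) (n : 'I_m -> nat)
    (Q : imx I (multi_index n) R[i]) x y (p : blocks m x y) :
    imx {ffun 'I_(size y) -> I} {ffun 'I_(size x) -> I} R[i] :=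
  let conjC := fun c : R[i] => c^* in
  let Qpow := word_power (colour_case Q (conjm conjC Q)) in
  let Qinv := adjm conjC Q in
  let Qinvpow := word_power (colour_case Qinv (conjm conjC Qinv)) in
  mulm (mulm (Qpow y) (part_matrix R[i] n p)) (Qinvpow x).

Definition spatial_partition_quantum_group_with (G : matrix_pair)
    (ublack : imx (basis_index G) (basis_index G) (function_algebra G)) :
    Prop :=
  compact_matrix_quantum_group G /\
  exists D : comultiplication (fundamental G),
    unitary_representation D ublack /\
    exists (m : nat) (n : 'I_m -> nat)
           (C : forall x y : word, blocks m x y -> Prop)
           (Q : imx (basis_index G) (multi_index n) R[i]),
      (0 < m)%N /\
      [/\ category C, rigid C, graded_category n C,
          unitarym (fun c : R[i] => c^*) Q &
          forall x y : word,
            hom (rep_power (fundamental G) ublack x)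
                (rep_power (fundamental G) ublack y)
            = lin_span [set T | exists2 p, C x y p & T = part_operator Q p]].

Definition spatial_partition_quantum_group (G : matrix_pair) : Prop :=
  exists ublack, @spatial_partition_quantum_group_with G ublack.

Definition gen_entry (A : cstarAlgType R) (I J : finType) (w : imx I J A) ij :
  w ij \in cstar_gen_pred (range w) :=
  introT (cstar_gen_predP _ _) (sub_gen_smallest (imageT w ij)).

(* G^z = (A, u^z), A being the C*-subalgebra generated by the entries of u^z. *)
Definition quantum_group_power (G : matrix_pair)
    (ublack : imx (basis_index G) (basis_index G) (function_algebra G))
    (z : word) : matrix_pair :=
  let w := rep_power (fundamental G) ublack z in
  @MatrixPair (cstar_sub (range w)) {ffun 'I_(size z) -> basis_index G}
    [ffun ij => CStarSub (gen_entry w ij)].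

End QuantumGroups.

(* Main.v *)
(* Each letter of a word over G^z is replaced by z or by the conjugate word of z,
   so that a partition on m |z| levels unfolds to a partition on m levels; the new
   category consists of the partitions that unfold into the given one.  A partition
   is determined by the labellings constant on its blocks, and in these terms the
   operations are relational composition, product and transposition; this makes
   the new category a rigid category, its cups being nested cups of the old one.
   The matrices of the given cups are invertible because the conjugate equations
   make their products diagonal with positive entries, so the representation of
   each colour is equivalent, by scalar matrices, to the conjugate of the other.
   Hence the power of the conjugate word is equivalent to the conjugate of u^z:
   its entries lie in the subalgebra generated by those of u^z, and it is the new
   associated representation.  The comultiplication restricts because
   *-homomorphisms of C*-algebras are contractive. *)

From HB Require Import structures.
From mathcomp Require Import all_boot all_order all_algebra zify.
Require Import Defs.

Set Implicit Arguments.
Unset Strict Implicit.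
Unset Printing Implicit Defensive.

(** * Partitions and labellings *)

(** A level of the new category is a pair of a letter of z and an old level. Over a black letter the
    copy of z runs backwards, and a level follows its letter, not its position. Hence nested cups
    join the levels of a letter to levels of the same letter, and the conjugate equations split over
    the letters of z.

    Composition is needed for two kinds of labels: arbitrary natural numbers, which determine a
    partition, and numbers below n, which index the entries of T_p. In both cases a labelling of the
    outer points has to extend to the middle points, including those of components that composition
    deletes. For bounded labels this works because the category is graded and every n_l is positive.

    The entries of a power of u^z along x are the entries of the power of u along the expanded word.
    The intertwiner equations for G^z are therefore equations already solved for G, and only the
    spanning partitions have to be translated.

    Contractivity of *-homomorphisms is obtained without spectral theory: a self-adjoint contraction
    is an average of two unitaries, which needs only a square root built by iteration. *)

Definition constant_on (T : finType) (L : Type) (p : {set {set T}})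
    (f : T -> L) : Prop :=
  forall B a b, B \in p -> a \in B -> b \in B -> f a = f b.

Lemma eq_constant_on (T : finType) L (p : {set {set T}}) (f g : T -> L) :
  f =1 g -> constant_on p f <-> constant_on p g.
Proof. by move=> e; split=> h B a b *; [rewrite -!e|rewrite !e]; apply: h; eauto. Qed.

Lemma partition_setTP (T : finType) (p : {set {set T}}) :
  reflect [/\ set0 \notin p, forall a, exists2 B, B \in p & a \in B
    & forall B B' a, B \in p -> B' \in p -> a \in B -> a \in B' -> B = B']
    (partition p [set: T]).
Proof.
apply: (iffP and3P) => [[/eqP cp tp p0]|[p0 cp tp]]; split=> //.
- move=> a; have : a \in cover p by rewrite cp.
  by case/bigcupP=> B; exists B.
- move=> B B' a pB pB' Ba B'a; apply/eqP/contraT => ne.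
  by have/disjoint_setI0/setP/(_ a) := trivIsetP tp B B' pB pB' ne; rewrite !inE Ba B'a.
- apply/eqP/setP=> a; rewrite inE; apply/bigcupP.
  by have [B ? ?] := cp a; exists B.
- apply/trivIsetP=> B B' pB pB'; apply: contraNT.
  by case/pred0Pn=> a /= /andP[? ?]; apply/eqP/(tp B B' a).
Qed.

(** The indicator function of [B] is constant on the blocks of [p], hence on [B'], so [B'] cannot
    leave [B]. *)
Lemma partition_sub_constant_on (T : finType) (p q : {set {set T}}) B B' a :
  partition p [set: T] -> (forall f : T -> nat, constant_on p f -> constant_on q f) ->
  B \in p -> B' \in q -> a \in B -> a \in B' -> B' \subset B.
Proof.
move=> /partition_setTP[_ _ tp] pq pB qB' Ba B'a; apply/subsetP=> b B'b.
have /(pq (fun c => nat_of_bool (c \in B)))/(_ B' a b qB' B'a B'b) :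
  constant_on p (fun c => nat_of_bool (c \in B)).
  move=> B1 c d pB1 B1c B1d; have [e|] := boolP (c \in B).
    by rewrite (tp B B1 c) // B1d.
  have [e|//] := boolP (d \in B).
  by rewrite (tp B B1 d) // B1c.
by rewrite Ba; case: (b \in B).
Qed.

Lemma partition_inj (T : finType) (p q : {set {set T}}) :
  partition p [set: T] -> partition q [set: T] ->
  (forall f : T -> nat, constant_on p f <-> constant_on q f) -> p = q.
Proof.
suff S p' q' : partition p' [set: T] -> partition q' [set: T] ->
    (forall f : T -> nat, constant_on p' f <-> constant_on q' f) -> p' \subset q'.
  by move=> hp hq e; apply/eqP; rewrite eqEsubset !S // => f; split=> /e.
move=> hp hq e; apply/subsetP=> B pB.
have [p0 _ _] := partition_setTP _ hp; have [_ cq _] := partition_setTP _ hq.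
have [B0|[a Ba]] := set_0Vmem B; first by rewrite B0 (negbTE p0) in pB.
have [B' qB' B'a] := cq a.
suff -> : B = B' by [].
by apply/eqP; rewrite eqEsubset; apply/andP; split;
  [apply: (partition_sub_constant_on hq _ qB' pB B'a Ba)
  |apply: (partition_sub_constant_on hp _ pB qB' Ba B'a)] => f /e.
Qed.

Lemma partition_imset_bij (T U : finType) (f : T -> U) (g : U -> T)
    (p : {set {set T}}) : cancel f g -> cancel g f -> partition p [set: T] ->
  partition [set f @: (B : {set T}) | B in p] [set: U].
Proof.
move=> fK gK /partition_setTP[p0 cp tp]; apply/partition_setTP; split.
- apply/imsetP=> -[B pB /esym/eqP]; rewrite imset_eq0 => /eqP B0.
  by rewrite B0 (negbTE p0) in pB.
- move=> u; have [B pB Bu] := cp (g u).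
  by exists (f @: B); [exact: imset_f|rewrite -[u]gK imset_f].
- move=> _ _ u /imsetP[B pB ->] /imsetP[B' pB' ->].
  case/imsetP=> b Bb -> /imsetP[b' B'b' /(can_inj fK) e].
  by rewrite (tp B B' b) // e.
Qed.

Section Satisfaction.
Variable m : nat.
Implicit Types (x y z : word) (i j : nat -> 'I_m -> nat).

(* Labels are total functions of a natural number position, so that they do
   not depend on the words and survive equations between words. *)
Definition labelling x y i j (a : point m x y) : nat :=
  match a.1 with inl k => j k a.2 | inr k => i k a.2 end.

Definition sat x y (p : blocks m x y) i j : Prop := constant_on p (labelling i j).

Lemma eq_sat x y (p : blocks m x y) i i' j j' :
  (forall k l, (k < size y)%N -> i k l = i' k l) ->
  (forall k l, (k < size x)%N -> j k l = j' k l) ->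
  sat p i j <-> sat p i' j'.
Proof.
by move=> ei ej; apply: eq_constant_on => -[[a|a] l]; rewrite /labelling /= ?ei ?ej.
Qed.

Lemma sat_inj x y (p q : blocks m x y) :
  is_spatial_partition p -> is_spatial_partition q ->
  (forall i j, sat p i j <-> sat q i j) -> p = q.
Proof.
move=> hp hq e; apply: partition_inj => // f.
pose i k l := if insub k is Some k' then f (inr k', l) else 0%N.
pose j k l := if insub k is Some k' then f (inl k', l) else 0%N.
suff /eq_constant_on ef : f =1 labelling i j by rewrite !ef; exact: e.
by move=> [[a|a] l]; rewrite /labelling /= /i /j valK.
Qed.

(** [C] is indexed by words, and equations such as [expand_cat] hold only propositionally. Since
    labels are indexed by natural numbers, both partitions can be tested on the same labellings
    although their types differ. *)
Lemma category_transport (C : forall x y : word, blocks m x y -> Prop)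
    x x' y y' (p : blocks m x y) (q : blocks m x' y') :
  category C -> C x y p -> x = x' -> y = y' -> is_spatial_partition q ->
  (forall i j, sat p i j <-> sat q i j) -> C x' y' q.
Proof.
move=> hC Cp ex ey; case: x' / ex q; case: y' / ey => q hq e.
by rewrite -(sat_inj (category_partition hC Cp) hq e).
Qed.

Lemma sat_inv x y (p : blocks m x y) i j : sat (part_inv p) i j <-> sat p j i.
Proof.
split=> h B a b.
  move=> pB Ba Bb; have := h (point_swap (y:=_) @: B) (point_swap a) (point_swap b).
  rewrite !imset_f // => /(_ isT isT isT).
  by case: a b {Ba Bb} => [[a|a] l] [[b|b] l'].
case/imsetP=> B' pB' -> /imsetP[a' Ba' ->] /imsetP[b' Bb' ->].
have := h B' a' b' pB' Ba' Bb'.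
by case: a' b' {Ba' Bb'} => [[a'|a'] l] [[b'|b'] l'].
Qed.

Lemma sat_tensor x y x' y' (p : blocks m x y) (q : blocks m x' y') i j :
  sat (part_tensor p q) i j <->
  sat p i j /\ sat q (fun k => i (size y + k)%N) (fun k => j (size x + k)%N).
Proof.
split=> [h|[hp hq] B a b].
  split=> B a b pB Ba Bb.
    have := h (point_left x' y' @: B) (point_left x' y' a) (point_left x' y' b).
    rewrite inE !imset_f // => /(_ isT isT isT).
    by case: a b {Ba Bb} => [[a|a] l] [[b|b] l'].
  have := h (@point_right _ x y _ _ @: B) (point_right x y a) (point_right x y b).
  rewrite inE !imset_f ?orbT // => /(_ isT isT isT).
  by case: a b {Ba Bb} => [[a|a] l] [[b|b] l'].
case/setUP=> /imsetP[B' pB' ->] /imsetP[a' Ba' ->] /imsetP[b' Bb' ->];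
  [have := hp B' a' b' pB' Ba' Bb'|have := hq B' a' b' pB' Ba' Bb'];
  by case: a' b' {Ba' Bb'} => [[a'|a'] l] [[b'|b'] l'].
Qed.

Lemma sat_id x i j :
  sat (part_id m x) i j <-> forall k l, (k < size x)%N -> i k l = j k l.
Proof.
split=> [h k l kx|h B a b].
  apply: (h [set (inl (Ordinal kx), l); (inr (Ordinal kx), l)]
    (inr (Ordinal kx), l) (inl (Ordinal kx), l)); rewrite ?set21 ?set22 //.
  by apply/imsetP; exists (Ordinal kx, l).
by case/imsetP=> -[k l] _ ->; rewrite !inE => /orP[]/eqP-> /orP[]/eqP->;
  rewrite /labelling //= h.
Qed.

Lemma part_inv_partition x y (p : blocks m x y) :
  is_spatial_partition p -> is_spatial_partition (part_inv p).
Proof.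
by apply: (@partition_imset_bij _ _ (@point_swap m x y) (@point_swap m y x));
  move=> [[a|a] l].
Qed.

Lemma part_id_partition x : is_spatial_partition (part_id m x).
Proof.
apply/partition_setTP; split.
- apply/imsetP=> -[[k l] _ /setP/(_ (inl k, l))]; by rewrite !inE eqxx.
- by move=> [[k|k] l]; exists [set (inl k, l); (inr k, l)];
  rewrite ?set21 ?set22 //; apply/imsetP; exists (k, l).
- move=> _ _ a /imsetP[[k l] _ ->] /imsetP[[k' l'] _ ->]; rewrite !inE /=.
  by case/orP=> /eqP-> /orP[]// /eqP[-> ->].
Qed.

Lemma point_left_inj x y x' y' : injective (@point_left m x y x' y').
Proof.
by move=> [[a|a] l] [[b|b] l'] //= [e <-];
  congr (_, _); congr (_ _); apply/val_inj.
Qed.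

Lemma point_right_inj x y x' y' : injective (@point_right m x y x' y').
Proof.
by move=> [[a|a] l] [[b|b] l'] //= [/addnI e <-];
  congr (_, _); congr (_ _); apply/val_inj.
Qed.

Lemma point_left_right_neq x y x' y' a b :
  @point_left m x y x' y' a <> point_right x y b.
Proof.
case: a b => [[a|a] l] [[b|b] l'] //= [e _];
  by have := ltn_ord a; rewrite e ltnNge leq_addr.
Qed.

Lemma point_tensorP x y x' y' (a : point m (x ++ x') (y ++ y')) :
  (exists b, a = point_left x' y' b) \/ (exists b, a = point_right x y b).
Proof.
case: a => [[a|a] l]; have := ltn_ord a; rewrite {2}size_cat => ha.
- case: (ltnP a (size x)) => h; [left; exists (inl (Ordinal h), l)|right].
    by congr (inl _, _); apply: val_inj.
  have h' : (a - size x < size x')%N by rewrite ltn_subLR.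
  by exists (inl (Ordinal h'), l); congr (inl _, _); apply: val_inj; rewrite /= subnKC.
- case: (ltnP a (size y)) => h; [left; exists (inr (Ordinal h), l)|right].
    by congr (inr _, _); apply: val_inj.
  have h' : (a - size y < size y')%N by rewrite ltn_subLR.
  by exists (inr (Ordinal h'), l); congr (inr _, _); apply: val_inj; rewrite /= subnKC.
Qed.

Lemma part_tensor_partition x y x' y' (p : blocks m x y) (q : blocks m x' y') :
  is_spatial_partition p -> is_spatial_partition q ->
  is_spatial_partition (part_tensor p q).
Proof.
move=> /partition_setTP[p0 cp tp] /partition_setTP[q0 cq tq].
apply/partition_setTP; split.
- rewrite inE negb_or; apply/andP; split; apply/imsetP=> -[B pB /esym/eqP];
    rewrite imset_eq0 => /eqP B0; first by rewrite B0 (negbTE p0) in pB.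
  by rewrite B0 (negbTE q0) in pB.
- move=> a; case: (point_tensorP a) => -[b ->].
    by have [B pB Bb] := cp b; exists (point_left x' y' @: B); rewrite ?inE !imset_f.
  have [B pB Bb] := cq b; exists (@point_right _ x y _ _ @: B); last by rewrite imset_f.
  by rewrite inE imset_f ?orbT.
- move=> _ _ a /setUP[]/imsetP[B pB ->] /setUP[]/imsetP[B' pB' ->];
    case/imsetP=> b Bb -> /imsetP[b' B'b'].
  + by move/point_left_inj=> e; rewrite (tp B B' b) // e.
  + by move/point_left_right_neq.
  + by move/esym/point_left_right_neq.
  + by move/point_right_inj=> e; rewrite (tq B B' b) // e.
Qed.

Section Composition.
Variables (x y z : word) (p : blocks m y z) (q : blocks m x y).

Let glued : {set {set point3 m x y z}} :=
  [set (@point_xy m x y z) @: (B : {set _}) | B in q]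
  :|: [set (@point_yz m x y z) @: (B : {set _}) | B in p].
Let touch := [rel a b | [exists B in glued, (a \in B) && (b \in B)]].

Let connect_touch_sym : connect_sym touch.
Proof.
by apply: sym_connect_sym => a b /=; apply: eq_existsb => B; rewrite [X in _ && X]andbC.
Qed.

Let part_compP B :
  reflect (exists c, B = (@point_xz m x y z) @^-1: [set b | connect touch c b] /\ B != set0)
    (B \in part_comp p q).
Proof.
rewrite !inE -/touch andbC; apply: (iffP andP).
  case=> /imsetP[_ /imsetP[c _ ->] ->] ne; exists c; split=> //.
  by apply/setP=> b; rewrite !inE.
case=> c [-> ne]; split=> //; apply/imsetP.
exists [set b in [set: point3 m x y z] | connect touch c b]; first exact: imset_f.
by apply/setP=> b; rewrite !inE.
Qed.

Lemma part_comp_partition : is_spatial_partition (part_comp p q).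
Proof.
apply/partition_setTP; split.
- by apply/part_compP => -[c []]; rewrite eqxx.
- move=> a; exists (@point_xz m x y z @^-1: [set b | connect touch (point_xz y a) b]).
    apply/part_compP; exists (point_xz y a); split=> //.
    by apply/set0Pn; exists a; rewrite !inE connect0.
  by rewrite !inE connect0.
- move=> _ _ a /part_compP[c [-> _]] /part_compP[c' [-> _]]; rewrite !inE => h h'.
  apply/setP=> b; rewrite !inE (same_connect connect_touch_sym h).
  by rewrite (same_connect connect_touch_sym h').
Qed.

(* A labelling of a composition extends to the middle points: a class meeting
   the outer points takes their label, the others a label allowed at the level
   of their root. *)
Lemma sat_comp (P : 'I_m -> nat -> Prop) (v0 : 'I_m -> nat) i j :
  (forall B a b v, B \in p -> a \in B -> b \in B -> P a.2 v -> P b.2 v) ->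
  (forall B a b v, B \in q -> a \in B -> b \in B -> P a.2 v -> P b.2 v) ->
  (forall l, P l (v0 l)) ->
  (forall k l, P l (i k l)) -> (forall k l, P l (j k l)) ->
  sat (part_comp p q) i j <->
  exists k, [/\ forall a l, P l (k a l), sat p i k & sat q k j].
Proof.
move=> Pp Pq Pv Pi Pj.
have touchP a b : touch a b ->
    (exists2 B, B \in q & exists a' b',
      [/\ a' \in B, b' \in B, a = point_xy z a' & b = point_xy z b'])
    \/ (exists2 B, B \in p & exists a' b',
      [/\ a' \in B, b' \in B, a = point_yz x a' & b = point_yz x b']).
  case/existsP=> B /andP[gB /andP[Ba Bb]].
  by case/setUP: gB Ba Bb => /imsetP[B' qB ->] /imsetP[a' ? ->] /imsetP[b' ? ->];
    [left|right]; exists B' => //; exists a', b'.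
have conn_ind (Q : point3 m x y z -> Prop) c d : connect touch c d ->
    (forall a b, touch a b -> Q a -> Q b) -> Q c -> Q d.
  move=> /connectP[s ps ->] h; elim: s c ps => //= a s IH c /andP[ca ps] Qc.
  by apply: IH ps _; apply: h ca Qc.
split=> [h|[k [Pk hp hq]]]; last first.
  pose g (a : point3 m x y z) := match a.1 with
    | inl (inl s) => j s a.2 | inl (inr s) => k s a.2 | inr s => i s a.2 end.
  have gt a b : touch a b -> g a = g b.
    case/touchP=> -[B hB [a' [b' [Ba Bb -> ->]]]].
      by have := hq B a' b' hB Ba Bb; case: a' b' {Ba Bb} => [[a'|a'] l] [[b'|b'] l'].
    by have := hp B a' b' hB Ba Bb; case: a' b' {Ba Bb} => [[a'|a'] l] [[b'|b'] l'].
  have gc a b : connect touch a b -> g a = g b.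
    move=> h; apply: (@conn_ind (fun b => g a = g b) a b h) => //.
    by move=> c d /gt <-.
  move=> B a b /part_compP[c [-> _]]; rewrite !inE => /gc ha /gc.
  by rewrite ha; case: a b {ha} => [[a|a] l] [[b|b] l'].
pose f (c : point m x z) := labelling i j c.
pose F (c : point3 m x y z) : nat :=
  if [pick b : point m x z | connect touch c (point_xz y b)] is Some b
  then f b else v0 (fingraph.root touch c).2.
have Fc c d : connect touch c d -> F c = F d.
  move=> cd; rewrite /F; have -> : fingraph.root touch c = fingraph.root touch d.
    by apply/eqP; rewrite root_connect.
  rewrite (eq_pick (Q := fun b => connect touch d (point_xz y b))) // => b.
  by rewrite (same_connect connect_touch_sym cd).
(* The outer points of one class form a block of the composition, on which the given labelling is
   constant; the outer point that is picked does not matter. *)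
have Ff b : F (point_xz y b) = f b.
  rewrite /F; case: pickP => [b' hb'|/(_ b)]; last by rewrite connect0.
  have /h hc : @point_xz m x y z @^-1: [set c | connect touch (point_xz y b) c]
      \in part_comp p q.
    apply/part_compP; exists (point_xz y b); split=> //.
    by apply/set0Pn; exists b; rewrite !inE connect0.
  by apply: hc; rewrite !inE ?connect0.
have PF c : P c.2 (F c).
  (* Blocks may join different levels. When [P l v] means [v < n l], the hypotheses [Pp] and [Pq]
     express gradedness. *)
  have PC a b v : connect touch a b -> P a.2 v -> P b.2 v.
    move=> ab; apply: (@conn_ind (fun b => P b.2 v) a b ab) => {a b ab} a b.
    case/touchP=> -[B hB [a' [b' [Ba Bb -> ->]]]].
      by move/(Pq B a' b' v hB Ba Bb).
    by move: Ba Bb; case: a' b' => [[a'|a'] l] [[b'|b'] l'] Ba Bb /(Pp B _ _ v hB Ba Bb).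
  rewrite /F; case: pickP => [b hb|_].
    apply: (PC (point_xz y b)); first by rewrite connect_touch_sym.
    by case: b {hb} => [[b|b] l]; rewrite /f /labelling /=.
  by apply: (PC (fingraph.root touch c)); rewrite ?Pv // connect_touch_sym connect_root.
pose k s l : nat := if insub s is Some s' then F (inl (inr s'), l) else v0 l.
have kE (s : 'I_(size y)) l : k s l = F (inl (inr s), l) by rewrite /k valK.
exists k; split.
- by move=> s l; rewrite /k; case: insub => [s'|//]; apply: (PF (_, l)).
- move=> B a b pB Ba Bb; transitivity (F (point_yz x a)).
    by case: a {Ba} => [[s|s] l]; [exact: kE|exact/esym/(Ff (inr s, l))].
  transitivity (F (point_yz x b)); last first.
    by case: b {Bb} => [[s|s] l]; [exact/esym/kE|exact: (Ff (inr s, l))].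
  apply/Fc/connect1/existsP; exists (@point_yz m x y z @: B).
  by rewrite inE !imset_f ?orbT.
- move=> B a b pB Ba Bb; transitivity (F (point_xy z a)).
    by case: a {Ba} => [[s|s] l]; [exact/esym/(Ff (inl s, l))|exact: kE].
  transitivity (F (point_xy z b)); last first.
    by case: b {Bb} => [[s|s] l]; [exact: (Ff (inl s, l))|exact/esym/kE].
  apply/Fc/connect1/existsP; exists (@point_xy m x y z @: B).
  by rewrite inE !imset_f.
Qed.

Lemma sat_comp_free i j :
  sat (part_comp p q) i j <-> exists k, sat p i k /\ sat q k j.
Proof.
rewrite (@sat_comp (fun _ _ => True) (fun _ => 0%N)) //.
by split=> -[k]; [case=> _ ? ?|case]; exists k.
Qed.

End Composition.
End Satisfaction.

(** * The category of partitions that unfold into a given one *)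

Definition flip_colour c := match c with White => Black | Black => White end.

Definition conj_word (z : word) : word := rev (map flip_colour z).

Definition expand_word (z x : word) : word :=
  flatten [seq colour_case z (conj_word z) c | c <- x].

Lemma flip_colourK : involutive flip_colour. Proof. by case. Qed.

Lemma size_conj_word z : size (conj_word z) = size z.
Proof. by rewrite size_rev size_map. Qed.

Lemma conj_wordK : involutive conj_word.
Proof. by move=> z; rewrite /conj_word map_rev revK mapK //; exact: flip_colourK. Qed.

Lemma expand_cat z x y : expand_word z (x ++ y) = expand_word z x ++ expand_word z y.
Proof. by rewrite /expand_word map_cat flatten_cat. Qed.

Lemma size_expand z x : size (expand_word z x) = (size x * size z)%N.
Proof.
elim: x => //= c x IH; rewrite /expand_word /= size_cat -/(expand_word z x) IH mulSn.
by case: c; rewrite /= ?size_conj_word.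
Qed.

(* Position, within the copy of z or of its conjugate at a letter c, of the
   a-th letter of z. *)
Definition letter_pos (L : nat) (c : colour) (a : nat) : nat :=
  colour_case a (L.-1 - a)%N c.

Lemma letter_posK L c a : (a < L)%N -> letter_pos L c (letter_pos L c a) = a.
Proof. by case: c => //=; rewrite /letter_pos /=; lia. Qed.

Lemma letter_pos_lt L c a : (a < L)%N -> (letter_pos L c a < L)%N.
Proof. by case: c => //=; rewrite /letter_pos /=; lia. Qed.

Lemma nth_expand z x k a : (k < size x)%N -> (a < size z)%N ->
  nth White (expand_word z x) (k * size z + letter_pos (size z) (nth White x k) a)
  = colour_case (nth White z a) (flip_colour (nth White z a)) (nth White x k).
Proof.
move=> + az; elim: x k => // c x IH [|k] /= kx; rewrite /expand_word /= nth_cat.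
  rewrite add0n; case: c => /=; first by rewrite az.
  have -> : ((size z).-1 - a < size (conj_word z))%N by rewrite size_conj_word; lia.
  rewrite nth_rev ?size_map; last lia.
  by rewrite (nth_map White); [congr (flip_colour (nth _ _ _)); lia|lia].
have -> : size (colour_case z (conj_word z) c) = size z.
  by case: c; rewrite /= ?size_conj_word.
rewrite mulSn -addnA ltnNge leq_addr /= addKn; exact: IH.
Qed.

Lemma expand_pos_lt z x k a : (k < size x)%N -> (a < size z)%N ->
  (k * size z + letter_pos (size z) (nth White x k) a < size (expand_word z x))%N.
Proof.
move=> kx az; rewrite size_expand.
have := letter_pos_lt (nth White x k) az; nia.
Qed.

Section Folding.
Variables (z : word) (m : nat).
Notation L := (size z).

(** Levels have to form an ordinal, so the pairs of a letter of [z] and an old level are numbered by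
    [enum_rank]. *)
Definition fold_levels : nat := #|{: 'I_L * 'I_m}|.
Notation m' := fold_levels.

Definition unfold_pos x (ka : 'I_(size x) * 'I_L) : 'I_(size (expand_word z x)) :=
  Ordinal (expand_pos_lt (ltn_ord ka.1) (ltn_ord ka.2)).

Lemma fold_pos_subproof x (s : 'I_(size (expand_word z x))) :
  (s %/ L < size x)%N && (letter_pos L (nth White x (s %/ L)) (s %% L) < L)%N.
Proof.
have := ltn_ord s; rewrite {2}size_expand => h.
have L0 : (0 < L)%N by lia.
by rewrite letter_pos_lt ?ltn_mod // ltn_divLR // h.
Qed.

Definition fold_pos x (s : 'I_(size (expand_word z x))) : 'I_(size x) * 'I_L :=
  (Ordinal (proj1 (andP (fold_pos_subproof s))),
   Ordinal (proj2 (andP (fold_pos_subproof s)))).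

Lemma unfold_posK x : cancel (@unfold_pos x) (@fold_pos x).
Proof.
move=> [k a]; have al := letter_pos_lt (nth White x k) (ltn_ord a).
have L0 : (0 < L)%N by lia.
have d : ((k * L + letter_pos L (nth White x k) a) %/ L = k)%N.
  by rewrite divnMDl // divn_small // addn0.
congr (_, _); apply: val_inj => //=.
by rewrite d modnMDl modn_small // letter_posK.
Qed.

Lemma fold_posK x : cancel (@fold_pos x) (@unfold_pos x).
Proof.
move=> s; apply: val_inj => /=.
have L0 : (0 < L)%N by have := ltn_ord s; rewrite {2}size_expand; lia.
by rewrite letter_posK ?ltn_mod // -divn_eq.
Qed.

Definition unfold_point x y (a : point m' x y) :
    point m (expand_word z x) (expand_word z y) :=
  (match a.1 with
   | inl k => inl (unfold_pos (k, (enum_val a.2).1))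
   | inr k => inr (unfold_pos (k, (enum_val a.2).1)) end, (enum_val a.2).2).

Definition fold_point x y (a : point m (expand_word z x) (expand_word z y)) :
    point m' x y :=
  match a.1 with
  | inl s => (inl (fold_pos s).1, enum_rank ((fold_pos s).2, a.2))
  | inr s => (inr (fold_pos s).1, enum_rank ((fold_pos s).2, a.2)) end.

Lemma unfold_pointK x y : cancel (@unfold_point x y) (@fold_point x y).
Proof.
by move=> [[k|k] l]; cbv beta iota delta [fold_point unfold_point fst snd];
  rewrite unfold_posK -[in RHS](enum_valK l); case: (enum_val l).
Qed.

Lemma fold_pointK x y : cancel (@fold_point x y) (@unfold_point x y).
Proof.
by move=> [[s|s] l]; cbv beta iota delta [fold_point unfold_point fst snd];
  rewrite enum_rankK -[in RHS](fold_posK s); case: (fold_pos s).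
Qed.

Definition unfold x y (p : blocks m' x y) : blocks m (expand_word z x) (expand_word z y) :=
  [set (@unfold_point x y) @: (B : {set _}) | B in p].

Definition fold x y (p : blocks m (expand_word z x) (expand_word z y)) : blocks m' x y :=
  [set (@fold_point x y) @: (B : {set _}) | B in p].

Lemma foldK x y : cancel (@fold x y) (@unfold x y).
Proof.
move=> p; rewrite /unfold /fold -imset_comp -[RHS]imset_id; apply: eq_imset => B /=.
by rewrite -imset_comp -[RHS]imset_id; apply: eq_imset => a /=; rewrite fold_pointK.
Qed.

Lemma unfold_partition x y (p : blocks m' x y) :
  is_spatial_partition p -> is_spatial_partition (unfold p).
Proof. exact: (partition_imset_bij (@unfold_pointK x y) (@fold_pointK x y)). Qed.

Lemma fold_partition x y (p : blocks m (expand_word z x) (expand_word z y)) :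
  is_spatial_partition p -> is_spatial_partition (fold p).
Proof. exact: (partition_imset_bij (@fold_pointK x y) (@unfold_pointK x y)). Qed.

Lemma constant_on_unfold x y (p : blocks m' x y) (U : Type)
    (f : point m (expand_word z x) (expand_word z y) -> U) :
  constant_on (unfold p) f <-> constant_on p (f \o @unfold_point x y).
Proof.
split=> [h B a b pB Ba Bb|h B a b]; first by apply: h; apply: imset_f; eassumption.
by case/imsetP=> B' pB' -> /imsetP[a' Ba' ->] /imsetP[b' Bb' ->]; exact: (h B').
Qed.

Definition fold_label x (I : nat -> 'I_m -> nat) : nat -> 'I_m' -> nat :=
  fun k l => I (k * L + letter_pos L (nth White x k) (enum_val l).1)%N
               (enum_val l).2.

(** The default 0 is reached only for empty [z]: otherwise the remainder modulo [L] always gives a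
    letter. *)
Definition unfold_label x (i : nat -> 'I_m' -> nat) : nat -> 'I_m -> nat :=
  fun s l => if insub (letter_pos L (nth White x (s %/ L)) (s %% L)) is Some a
             then i (s %/ L)%N (enum_rank (a, l)) else 0%N.

Lemma unfold_labelK x i k l : fold_label x (unfold_label x i) k l = i k l.
Proof.
rewrite /fold_label /unfold_label.
have := letter_pos_lt (nth White x k) (ltn_ord (enum_val l).1) => al.
have L0 : (0 < L)%N by lia.
rewrite divnMDl // divn_small // addn0 modnMDl modn_small // letter_posK //.
by rewrite valK -surjective_pairing enum_valK.
Qed.

Lemma sat_unfold x y (p : blocks m' x y) I J :
  sat (unfold p) I J <-> sat p (fold_label y I) (fold_label x J).
Proof. by rewrite /sat constant_on_unfold; apply: eq_constant_on => -[[k|k] l]. Qed.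

Variable C : forall x y : word, blocks m x y -> Prop.

Definition fold_category x y (p : blocks m' x y) : Prop :=
  is_spatial_partition p /\ C (unfold p).

Hypothesis hC : category C.

(** Tensor products of the identities of the two letters reach the nonempty words. This is one place
    where [z] has to be nonempty. *)
Lemma category_id x : (0 < size x)%N -> C (part_id m x).
Proof.
have id1 c : C (part_id m [:: c]).
  by case: c; [exact: (category_id_white hC)|exact: (category_id_black hC)].
case: x => // c x _; elim: x c => // c' x IH c.
apply: (category_transport hC (category_tensor hC (id1 c) (IH c'))) => //.
  exact: part_id_partition.
move=> i j; rewrite sat_tensor !sat_id /=; split=> [[h h'] [|k] l kx|h].
- exact: h.
- exact: (h' k l).
- by split=> k l kx; apply: h; lia.
Qed.

Lemma fold_category_id c : (0 < L)%N -> fold_category (part_id m' [:: c]).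
Proof.
move=> L0; split; first exact: part_id_partition.
have e : colour_case z (conj_word z) c = expand_word z [:: c] by rewrite /expand_word /= cats0.
have ne : (0 < size (colour_case z (conj_word z) c))%N.
  by case: c {e}; rewrite /= ?size_conj_word.
apply: (category_transport hC (category_id ne) e e).
  exact/unfold_partition/part_id_partition.
have sz : size (colour_case z (conj_word z) c) = L.
  by case: c {e ne}; rewrite /= ?size_conj_word.
move=> I J; rewrite sat_unfold !sat_id sz /=; split=> h.
  move=> [|k] l // _; rewrite /fold_label; apply: h; rewrite mul0n add0n.
  exact: letter_pos_lt.
move=> s l sL; have := h 0%N (enum_rank (Ordinal (letter_pos_lt c sL), l)) isT.
by rewrite /fold_label enum_rankK /= mul0n add0n letter_posK.
Qed.

Lemma fold_categoryP : (0 < L)%N -> category fold_category.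
Proof.
move=> L0; split.
- by move=> x y p [].
- move=> x y w p q [pp Cp] [pq Cq]; split; first exact: part_comp_partition.
  apply: (category_transport hC (category_comp hC Cp Cq)) => //.
    exact/unfold_partition/part_comp_partition.
  (* A middle labelling along [expand_word z y] folds to one along [y], and conversely. *)
  move=> I J; rewrite sat_unfold !sat_comp_free; split=> -[k []].
    by rewrite !sat_unfold; exists (fold_label y k).
  move=> hp hq; exists (unfold_label y k); rewrite !sat_unfold.
  by split; [apply: (iffLR (@eq_sat _ _ _ p _ _ _ _ _ _) hp)
            |apply: (iffLR (@eq_sat _ _ _ q _ _ _ _ _ _) hq)] => // *;
    rewrite unfold_labelK.
- move=> x y x' y' p q [pp Cp] [pq Cq]; split; first exact: part_tensor_partition.
  apply: (category_transport hC (category_tensor hC Cp Cq)).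
  + by rewrite expand_cat.
  + by rewrite expand_cat.
  + exact/unfold_partition/part_tensor_partition.
  + have el w w' I k l : (k < size w)%N -> fold_label (w ++ w') I k l = fold_label w I k l.
      by move=> kw; rewrite /fold_label nth_cat kw.
    have er w w' I k l : fold_label (w ++ w') I (size w + k)%N l
        = fold_label w' (fun s => I (size (expand_word z w) + s)%N) k l.
      by rewrite /fold_label nth_cat ltnNge leq_addr /= addKn size_expand mulnDl addnA.
    move=> I J; rewrite sat_unfold !sat_tensor !sat_unfold.
    by split=> -[hp hq]; split;
      [move: hp|move: hq|move: hp|move: hq]; apply: iffLR; apply: eq_sat => *;
      rewrite ?er ?el.
- move=> x y p [pp Cp]; split; first exact: part_inv_partition.
  apply: (category_transport hC (category_inv hC Cp)) => //.
    exact/unfold_partition/part_inv_partition.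
  by move=> I J; rewrite sat_unfold !sat_inv sat_unfold.
- exact: fold_category_id.
- exact: fold_category_id.
Qed.

Lemma fold_category_graded (n : 'I_m -> nat) : graded_category n C ->
  graded_category (fun l : 'I_m' => n (enum_val l).2) fold_category.
Proof.
move=> gC x y p [_ Cp] B a b pB Ba Bb.
apply: (gC _ _ _ Cp (@unfold_point x y @: B) (unfold_point a) (unfold_point b));
  exact: imset_f.
Qed.

End Folding.

(** A cup as a binary relation between the labellings of its two lower positions. There are no upper
    points, so the constant 0 stands for any upper labelling. *)
Definition cup_rel m c (r : blocks m [::] [:: c; flip_colour c])
    (alpha beta : 'I_m -> nat) : Prop :=
  sat r (fun k => if k is 0%N then alpha else beta) (fun _ _ => 0%N).

Lemma sat_cup m c (r : blocks m [::] [:: c; flip_colour c]) i j :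
  sat r i j <-> cup_rel r (i 0%N) (i 1%N).
Proof. by apply: eq_sat => //= -[|[|]]. Qed.

Lemma eq_cup_rel m c (r : blocks m [::] [:: c; flip_colour c]) a a' b b' :
  a =1 a' -> b =1 b' -> cup_rel r a b <-> cup_rel r a' b'.
Proof. by move=> ea eb; apply: eq_sat => //= -[|k] l _; rewrite ?ea ?eb. Qed.

(** The three middle positions carry [j 0], [beta] and [i 0]: the identity strands fix the outer
    two, and the cups relate each of them to [beta]. The snake is thus the relational composite of
    its two cups. [s] and [s'] are the same cup at two types, which agree once [c] is a concrete
    colour. *)
Lemma sat_snake m (P : 'I_m -> nat -> Prop) (v0 : 'I_m -> nat) c
    (r : blocks m [::] [:: c; flip_colour c])
    (s : blocks m [::] [:: flip_colour c; c])
    (s' : blocks m [::] [:: flip_colour c; flip_colour (flip_colour c)]) i j :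
  (forall i j, sat s i j <-> sat s' i j) ->
  (forall B a b v, B \in part_tensor (part_inv r) (part_id m [:: c]) ->
     a \in B -> b \in B -> P a.2 v -> P b.2 v) ->
  (forall B a b v, B \in part_tensor (part_id m [:: c]) s ->
     a \in B -> b \in B -> P a.2 v -> P b.2 v) ->
  (forall l, P l (v0 l)) ->
  (forall k l, P l (i k l)) -> (forall k l, P l (j k l)) ->
  sat (part_comp (part_tensor (part_inv r) (part_id m [:: c]) :
          blocks m [:: c; flip_colour c; c] [:: c])
        (part_tensor (part_id m [:: c]) s :
          blocks m [:: c] [:: c; flip_colour c; c])) i j <->
  exists beta, [/\ forall l, P l (beta l), cup_rel r (j 0%N) beta
    & cup_rel s' beta (i 0%N)].
Proof.
move=> es Pp Pq Pv Pi Pj; rewrite (sat_comp _ _ Pv) //.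
have tr := @sat_tensor m [:: c; flip_colour c] [::] [:: c] [:: c] (part_inv r) (part_id m _).
have ts := @sat_tensor m [:: c] [:: c] [::] [:: flip_colour c; c] (part_id m _) s.
split.
  move=> [k [Pk /tr[/sat_inv/sat_cup hr /sat_id hi] /ts[/sat_id hj /es/sat_cup hs]]].
  exists (k 1%N); split=> //.
    by move: hr; apply: iffLR; apply: eq_cup_rel => //= l; exact: hj.
  by move: hs; apply: iffLR; apply: eq_cup_rel => //= l; exact/esym/(hi 0%N).
move=> [beta [Pb hr hs]].
exists (fun k => match k with 0%N => j 0%N | 1%N => beta | _ => i 0%N end); split.
- by move=> [|[|?]] l.
- by apply/tr; split; [apply/sat_inv/sat_cup|apply/sat_id => -[]].
- by apply/ts; split; [apply/sat_id => -[]|apply/es/sat_cup].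
Qed.

Section Rigidity.
Variables (m : nat) (C : forall x y : word, blocks m x y -> Prop).
Hypothesis hC : category C.
Variable cup : forall c, blocks m [::] [:: c; flip_colour c].
Hypothesis Ccup : forall c, C (cup c).

(** By induction, the smaller nest is placed between two identity strands, which the cup of the new
    letter then closes. The last position of [z ++ conj_word z] is [(size z).*2.-1], and mirrored
    positions add up to it. *)
Lemma nested_cup z : exists p : blocks m [::] (z ++ conj_word z), C p /\
  forall i j, sat p i j <-> forall a, (a < size z)%N ->
    cup_rel (cup (nth White z a)) (i a) (i ((size z).*2.-1 - a)%N).
Proof.
elim: z => [|c z [p [Cp hp]]].
  (* The empty partition arises as a cup closed by its own involution, all of whose points are
     deleted. *)
  exists (part_comp (part_inv (cup White)) (cup White)); split.
    by apply: category_comp => //; apply: category_inv.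
  by move=> i j; split=> // _ B [[[]//|[]//] ?].
have id1 d : C (part_id m [:: d]).
  by case: d; [exact: (category_id_white hC)|exact: (category_id_black hC)].
pose t := part_tensor (part_tensor (part_id m [:: c]) p) (part_id m [:: flip_colour c]).
have Ct : C t by apply: category_tensor => //; apply: category_tensor.
have := category_comp hC Ct (Ccup c); rewrite /t.
set q := part_comp _ _ => Cq.
have ew : ([:: c] ++ (z ++ conj_word z)) ++ [:: flip_colour c]
    = (c :: z) ++ conj_word (c :: z).
  by rewrite /conj_word /= rev_cons -cats1 catA.
have hq i j : sat q i j <-> forall a, (a < (size z).+1)%N ->
    cup_rel (cup (nth White (c :: z) a)) (i a) (i ((size z).+1.*2.-1 - a)%N).
  have es : size ([:: c] ++ (z ++ conj_word z)) = (size z).*2.+1.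
    by rewrite /= size_cat size_conj_word addnn.
  rewrite sat_comp_free; split=> [[k []]|h].
    move=> /sat_tensor[/sat_tensor[/sat_id h0 /hp h1] /sat_id h2] /sat_cup h3.
    move=> [_|a az] /=.
      move: h3; apply: iffLR; apply: eq_cup_rel => l /=; first exact/esym/h0.
      have := h2 0%N l isT; rewrite es /= => <-; congr (i _ _); lia.
    have := h1 a az; rewrite /=; apply: iffLR; apply: eq_cup_rel => l //=.
    congr (i _ _); lia.
  (* The middle row consists of the two ends of the outermost cup, at positions 0 and
     [(size z).*2.+1] of the longer word. *)
  exists (fun k => match k with 0%N => i 0%N | _ => i (size z).*2.+1 end); split.
    apply/sat_tensor; split; first (apply/sat_tensor; split).
    - by apply/sat_id => -[].
    - apply/hp => a az; have := h a.+1 az; apply: iffLR; apply: eq_cup_rel => l //=.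
      congr (i _ _); lia.
    - by apply/sat_id => -[] //= l _; rewrite size_cat size_conj_word addnn addn0.
  apply/sat_cup; have := h 0%N isT; apply: iffLR; apply: eq_cup_rel => l //=.
case: _ / ew.
by exists q.
Qed.

End Rigidity.

Lemma unfold_labelE z m x i k (a : 'I_(size z)) (l : 'I_m) :
  unfold_label x i (k * size z + letter_pos (size z) (nth White x k) a) l
  = i k (enum_rank (a, l)).
Proof.
have al := letter_pos_lt (nth White x k) (ltn_ord a).
have L0 : (0 < size z)%N by lia.
rewrite /unfold_label divnMDl // divn_small // addn0 modnMDl modn_small //.
by rewrite letter_posK // valK.
Qed.

Lemma sat_fold z m x y (p : blocks m (expand_word z x) (expand_word z y)) i j :
  sat (fold p) i j <-> sat p (unfold_label y i) (unfold_label x j).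
Proof.
rewrite -{2}[p]foldK sat_unfold.
by apply: eq_sat => k l _; rewrite unfold_labelK.
Qed.

Section FoldRigid.
Variables (z : word) (m : nat) (C : forall x y : word, blocks m x y -> Prop).
Hypothesis hC : category C.
Notation L := (size z).
Notation m' := (fold_levels z m).

(** One of the two copies of [z] below the cup is reversed, so the nest joins each letter of [z] to
    itself. The folded cup is then a conjunction of independent old cups, one for each letter. *)
Lemma fold_cup (cup : forall c, blocks m [::] [:: c; flip_colour c]) c :
  (forall c, C (cup c)) ->
  exists p : blocks m' [::] [:: c; flip_colour c], fold_category C p /\
  forall alpha beta, cup_rel p alpha beta <-> forall a : 'I_L,
    cup_rel (cup (colour_case (nth White z a) (flip_colour (nth White z a)) c))
      (fun l => alpha (enum_rank (a, l))) (fun l => beta (enum_rank (a, l))).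
Proof.
move=> Ccup; pose w := colour_case z (conj_word z) c.
have sw : size w = L by rewrite /w; case: c {w}; rewrite /= ?size_conj_word.
have ew : w ++ conj_word w = expand_word z [:: c; flip_colour c].
  by rewrite /expand_word /= cats0 /w; case: c {w sw}; rewrite /= ?conj_wordK.
have nw (a : 'I_L) : nth White w (letter_pos L c a)
    = colour_case (nth White z a) (flip_colour (nth White z a)) c.
  have := @nth_expand z [:: c] 0 a isT (ltn_ord a).
  by rewrite /expand_word /= cats0.
have [p0 [Cp0]] := nested_cup hC Ccup w; rewrite sw.
move: p0 Cp0; rewrite ew => p Cp hp.
exists (fold (p : blocks m (expand_word z [::]) _)); split.
  by split; [apply: fold_partition; exact: (category_partition hC Cp)|rewrite foldK].
move=> alpha beta; rewrite /cup_rel sat_fold hp -/(cup_rel _ _ _).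
set x := [:: c; _]; set i := fun k : nat => _.
have e0 (a : 'I_L) l : unfold_label x i (letter_pos L c a) l = alpha (enum_rank (a, l)).
  by rewrite -[letter_pos L c a]add0n -(mul0n L) unfold_labelE.
(* The second copy starts at [L] and has the opposite orientation: the mirror image of
   [letter_pos L c a] is [L + letter_pos L (flip_colour c) a]. *)
have e1 (a : 'I_L) l : unfold_label x i (L.*2.-1 - letter_pos L c a)%N l
    = beta (enum_rank (a, l)).
  rewrite -[RHS]/(i 1%N _) -(unfold_labelE x); congr (unfold_label _ _ _ _).
  by have := ltn_ord a; rewrite /letter_pos /=; clear; case: c => /=; lia.
split=> h a.
  have := h (letter_pos L c a) (letter_pos_lt c (ltn_ord a)); rewrite nw.
  by apply: iffLR; apply: eq_cup_rel => l; rewrite ?e0 ?e1.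
move=> aL; have lt := letter_pos_lt c aL.
have := h (Ordinal lt); rewrite -nw /= letter_posK //.
have ea : letter_pos L c (Ordinal lt) = a by rewrite /= letter_posK.
by apply: iffLR; apply: eq_cup_rel => l; rewrite -?e0 -?e1 ea.
Qed.

Lemma snake_partition c (r : blocks m' [::] [:: c; flip_colour c])
    (s : blocks m' [::] [:: flip_colour c; c])
    (s' : blocks m' [::] [:: flip_colour c; flip_colour (flip_colour c)]) :
  is_spatial_partition r -> is_spatial_partition s ->
  (forall i j, sat s i j <-> sat s' i j) ->
  (forall alpha gamma, (exists beta, cup_rel r alpha beta /\ cup_rel s' beta gamma)
     <-> alpha =1 gamma) ->
  part_comp (part_tensor (part_inv r) (part_id m' [:: c]) :
      blocks m' [:: c; flip_colour c; c] [:: c])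
    (part_tensor (part_id m' [:: c]) s :
      blocks m' [:: c] [:: c; flip_colour c; c]) = part_id m' [:: c].
Proof.
move=> pr ps es h; apply: sat_inj; [exact: part_comp_partition|exact: part_id_partition|].
move=> i j; rewrite (sat_snake (P := fun _ _ => True) (v0 := fun _ => 0%N) es) //.
rewrite sat_id; have := h (j 0%N) (i 0%N) => {}h; split.
  by case=> beta [_ hr hs] [|//] l _; rewrite (iffLR h) //; exists beta.
move=> e; have /h[beta [hr hs]] : j 0%N =1 i 0%N by move=> l; rewrite e.
by exists beta.
Qed.

(* Choosing middle labels level by level reduces the conjugate equations of the
   folded cups to those of the given ones, letter by letter. *)
Lemma fold_category_rigid : rigid C -> rigid (@fold_category z m C).
Proof.
move=> [r [s [Cr Cs snW snB]]].
pose cup c : blocks m [::] [:: c; flip_colour c] :=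
  match c with White => r | Black => s end.
have Ccup c : C (cup c) by case: c.
have snake c alpha gamma : (exists beta, cup_rel (cup c) alpha beta /\
    cup_rel (cup (flip_colour c)) beta gamma) <-> alpha =1 gamma.
  have := @sat_id m [:: c] (fun _ => gamma) (fun _ => alpha).
  have iffs : sat (part_id m [:: c]) (fun _ => gamma) (fun _ => alpha) <->
      exists beta, [/\ (forall l : 'I_m, True), cup_rel (cup c) alpha beta
        & cup_rel (cup (flip_colour c)) beta gamma].
    case: c.
    - rewrite -snW; apply: (@sat_snake m (fun _ _ => True) (fun _ => 0%N) White r s s);
        by [].
    - rewrite -snB; apply: (@sat_snake m (fun _ _ => True) (fun _ => 0%N) Black s r r);
        by [].
  rewrite iffs /= => sid; split.
    case=> beta [h1 h2] l; apply/esym; apply: (iffLR sid _ 0%N l isT).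
    by exists beta.
  move=> e; have [|beta [_ ? ?]] := iffRL sid; first by move=> k l _; rewrite e.
  by exists beta.
have [r' [Cr' hr']] := fold_cup White Ccup.
have [s' [Cs' hs']] := fold_cup Black Ccup.
have fsnake c (p : blocks m' [::] [:: c; flip_colour c])
    (q : blocks m' [::] [:: flip_colour c; flip_colour (flip_colour c)]) :
  (forall alpha beta, cup_rel p alpha beta <-> forall a : 'I_L,
    cup_rel (cup (colour_case (nth White z a) (flip_colour (nth White z a)) c))
      (fun l => alpha (enum_rank (a, l))) (fun l => beta (enum_rank (a, l)))) ->
  (forall alpha beta, cup_rel q alpha beta <-> forall a : 'I_L,
    cup_rel (cup (flip_colour (colour_case (nth White z a) (flip_colour (nth White z a)) c)))
      (fun l => alpha (enum_rank (a, l))) (fun l => beta (enum_rank (a, l)))) ->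
  forall alpha gamma, (exists beta, cup_rel p alpha beta /\ cup_rel q beta gamma)
     <-> alpha =1 gamma.
  move=> hp hq alpha gamma; split.
    move=> [beta [/hp h1 /hq h2]] l; rewrite -(enum_valK l); case: (enum_val l) => a l'.
    exact: (iffLR (snake _ _ _) (ex_intro _ _ (conj (h1 a) (h2 a))) l').
  move=> e; have hb (a : 'I_L) := iffRL (snake (colour_case (nth White z a)
    (flip_colour (nth White z a)) c) (fun l => alpha (enum_rank (a, l)))
    (fun l => gamma (enum_rank (a, l)))) (fun l => e _).
  have [beta hbeta] := fin_all_exists hb.
  exists (fun l => beta (enum_val l).1 (enum_val l).2); split.
    apply/hp => a; have [h _] := hbeta a; move: h; apply: iffLR.
    by apply: eq_cup_rel => l //; rewrite enum_rankK.
  apply/hq => a; have [_ h] := hbeta a; move: h; apply: iffLR.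
  by apply: eq_cup_rel => l //; rewrite enum_rankK.
have [pr _] := Cr'; have [ps _] := Cs'.
exists r', s'; split=> //.
- apply: (@snake_partition White r' s' s') => //; apply: fsnake => // alpha beta.
- apply: (@snake_partition Black s' r' r') => //; apply: fsnake => // alpha beta.
  by rewrite hr'; split=> h a; have := h a; rewrite /= flip_colourK.
Qed.

End FoldRigid.

(** * Ordered products of matrices *)

Import GRing.Theory.
Local Open Scope ring_scope.

Section MatrixTheory.
Variable A : pzRingType.

Lemma mulmE (I J K : finType) (u : imx I J A) (v : imx J K A) i k :
  mulm u v (i, k) = \sum_j u (i, j) * v (j, k).
Proof. by rewrite ffunE. Qed.

Lemma idmE (I : finType) i j : idm A I (i, j) = (i == j)%:R.
Proof. by rewrite ffunE. Qed.

Lemma mulmA (I J K L : finType) (u : imx I J A) (v : imx J K A) (w : imx K L A) :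
  mulm u (mulm v w) = mulm (mulm u v) w.
Proof.
apply/ffunP=> -[i l]; rewrite !mulmE.
under eq_bigr do rewrite mulmE mulr_sumr.
rewrite exchange_big; apply: eq_bigr => k _ /=; rewrite mulmE mulr_suml.
by apply: eq_bigr => j _; rewrite mulrA.
Qed.

Lemma mul1m (I J : finType) (u : imx I J A) : mulm (idm A I) u = u.
Proof.
apply/ffunP=> -[i j]; rewrite mulmE (bigD1 i) //= idmE eqxx mul1r big1 ?addr0 //.
by move=> k /negbTE ki; rewrite idmE eq_sym ki mul0r.
Qed.

Lemma mulm1 (I J : finType) (u : imx I J A) : mulm u (idm A J) = u.
Proof.
apply/ffunP=> -[i j]; rewrite mulmE (bigD1 j) //= idmE eqxx mulr1 big1 ?addr0 //.
by move=> k /negbTE ki; rewrite idmE ki mulr0.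
Qed.

Lemma invertible_mul (I : finType) (u v : imx I I A) :
  invertible u -> invertible v -> invertible (mulm u v).
Proof.
move=> [u' [uu' u'u]] [v' [vv' v'v]]; exists (mulm v' u'); split.
  by rewrite -mulmA (mulmA v) vv' mul1m.
by rewrite -mulmA (mulmA u') u'u mul1m.
Qed.

End MatrixTheory.

Definition ffun_rev n (I : Type) (f : {ffun 'I_n -> I}) : {ffun 'I_n -> I} :=
  [ffun k => f (rev_ord k)].

Lemma ffun_revK n I : involutive (@ffun_rev n I).
Proof. by move=> f; apply/ffunP=> k; rewrite !ffunE rev_ordK. Qed.

Lemma sum_ffun_recr (V : nmodType) n (J : finType) (G : {ffun 'I_n.+1 -> J} -> V) :
  \sum_f G f = \sum_(g : {ffun 'I_n -> J}) \sum_(a : J)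
    G [ffun k => if unlift ord_max k is Some k' then g k' else a].
Proof.
pose ext (ga : {ffun 'I_n -> J} * J) : {ffun 'I_n.+1 -> J} :=
  [ffun k => if unlift ord_max k is Some k' then ga.1 k' else ga.2].
rewrite pair_big /= (reindex ext) //; apply: onW_bij.
exists (fun f : {ffun 'I_n.+1 -> J} => ([ffun k => f (lift ord_max k)], f ord_max)) => [[g a]|f].
  by congr (_, _); [apply/ffunP=> k|]; rewrite !ffunE ?liftK ?unlift_none.
by apply/ffunP=> k; rewrite ffunE /=; case: unliftP => [k' ->|->]; rewrite ?ffunE.
Qed.

Section Products.
Variable A : pzRingType.

Definition mxprod n (I J : finType) (W : 'I_n -> imx I J A) :
    imx {ffun 'I_n -> I} {ffun 'I_n -> J} A :=
  [ffun ij : {ffun 'I_n -> I} * {ffun 'I_n -> J} =>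
    \prod_(k < n) W k (ij.1 k, ij.2 k)].

(* The product in decreasing order: inverses and adjoints reverse the order. *)
Definition mxprod_rev n (I J : finType) (W : 'I_n -> imx I J A) :
    imx {ffun 'I_n -> I} {ffun 'I_n -> J} A :=
  [ffun ij : {ffun 'I_n -> I} * {ffun 'I_n -> J} =>
    \prod_(k < n) W (rev_ord k) (ij.1 (rev_ord k), ij.2 (rev_ord k))].

Lemma mxprod_revE n (I J : finType) (W : 'I_n -> imx I J A) i j :
  mxprod_rev W (i, j) = mxprod (W \o @rev_ord n) (ffun_rev i, ffun_rev j).
Proof. by rewrite !ffunE /=; apply: eq_bigr => k _; rewrite !ffunE. Qed.

Lemma mxprodE_rev n (I J : finType) (W : 'I_n -> imx I J A) i j :
  mxprod W (i, j) = mxprod_rev (W \o @rev_ord n) (ffun_rev i, ffun_rev j).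
Proof.
by rewrite !ffunE /=; apply: eq_bigr => k _; rewrite !ffunE rev_ordK.
Qed.

(** In the product W_0 ... W_(n-1) V_(n-1) ... V_0 the two innermost factors carry the last index.
    Summing over it gives 0 or 1, which is central, and the induction goes on with the remaining
    factors. With both products in increasing order these factors would not be adjacent. *)
Lemma mxprod_mul_rev n (I J : finType) (W : 'I_n -> imx I J A) (V : 'I_n -> imx J I A) :
  (forall k, mulm (W k) (V k) = idm A I) ->
  mulm (mxprod W) (mxprod_rev V) = idm A {ffun 'I_n -> I}.
Proof.
elim: n W V => [|n IH] W V WV; apply/ffunP=> -[i l]; rewrite mulmE idmE.
  rewrite (eq_bigr (fun=> 1)) => [|f _]; last by rewrite !ffunE !big_ord0 mulr1.
  have f0 (f : {ffun 'I_0 -> I}) : f = i by apply/ffunP=> -[].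
  rewrite (f0 l) eqxx sumr_const (_ : #|_| = 1%N) //.
  by rewrite card_ffun card_ord expn0.
rewrite sum_ffun_recr.
pose i' := [ffun k => i (lift ord_max k)] : {ffun 'I_n -> I}.
pose l' := [ffun k => l (lift ord_max k)] : {ffun 'I_n -> I}.
have lE (k : 'I_n) : widen_ord (leqnSn n) k = lift ord_max k.
  by apply: val_inj; exact/esym/lift_max.
transitivity (\sum_(g : {ffun 'I_n -> J}) \sum_(a : J)
    mxprod (W \o lift ord_max) (i', g) *
    (W ord_max (i ord_max, a) * V ord_max (a, l ord_max)) *
    mxprod_rev (V \o lift ord_max) (g, l')).
  apply: eq_bigr => g _; apply: eq_bigr => a _; rewrite !ffunE /=.
  rewrite big_ord_recr big_ord_recl /= !ffunE unlift_none.
  have -> : rev_ord ord0 = ord_max :> 'I_n.+1 by apply: val_inj; rewrite /= subSS subn0.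
  rewrite unlift_none !mulrA; congr (_ * _ * _ * _).
    by apply: eq_bigr => k _; rewrite !ffunE lE liftK.
  apply: eq_bigr => k _; have -> : rev_ord (lift ord0 k) = lift ord_max (rev_ord k).
    by apply: val_inj; rewrite [RHS]lift_max /= /bump leq0n add1n subSS.
  by rewrite !ffunE liftK.
transitivity (\sum_(g : {ffun 'I_n -> J}) mxprod (W \o lift ord_max) (i', g) *
    (i ord_max == l ord_max)%:R * mxprod_rev (V \o lift ord_max) (g, l')).
  apply: eq_bigr => g _; rewrite -mulr_suml -mulr_sumr.
  by rewrite -mulmE WV idmE.
have eil : (i == l) = (i ord_max == l ord_max) && (i' == l').
  apply/eqP/andP => [il|[/eqP em /eqP e']]; first by rewrite /i' il !eqxx.
  apply/ffunP=> k.
  case: (unliftP ord_max k) => [k' ->|->] //.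
  by move/ffunP/(_ k'): e'; rewrite !ffunE.
have := IH (W \o lift ord_max) (V \o lift ord_max) (fun k => WV _).
move=> /ffunP/(_ (i', l')); rewrite mulmE idmE => h.
rewrite eil; case: (_ == _); rewrite /= -?h.
  by apply: eq_bigr => g _; rewrite mulr1.
by rewrite big1 // => g _; rewrite mulr0 mul0r.
Qed.

Lemma mxprod_rev_mul n (I J : finType) (W : 'I_n -> imx I J A) (V : 'I_n -> imx J I A) :
  (forall k, mulm (V k) (W k) = idm A J) ->
  mulm (mxprod_rev V) (mxprod W) = idm A {ffun 'I_n -> J}.
Proof.
move=> VW; apply/ffunP=> -[i l]; rewrite mulmE idmE.
have := mxprod_mul_rev (W := V \o @rev_ord n) (V := W \o @rev_ord n) (fun k => VW _).
move=> /ffunP/(_ (ffun_rev i, ffun_rev l)); rewrite mulmE idmE.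
rewrite (inj_eq (can_inj (@ffun_revK n J))) => <-.
rewrite (reindex_inj (can_inj (@ffun_revK n I))) /=.
by apply: eq_bigr => f _; rewrite mxprod_revE [mxprod W _]mxprodE_rev !ffun_revK.
Qed.

Section Conjugation.
Variable conj : A -> A.
Hypotheses (conj1 : conj 1 = 1) (conjM : forall a b, conj (a * b) = conj b * conj a).

Lemma conj_prod n (F : 'I_n -> A) :
  conj (\prod_(k < n) F k) = \prod_(k < n) conj (F (rev_ord k)).
Proof.
elim: n F => [|n IH] F; first by rewrite !big_ord0.
rewrite big_ord_recr [RHS]big_ord_recl conjM IH; congr (conj (F _) * _).
  by apply: val_inj; rewrite /= subSS subn0.
apply: eq_bigr => k _; congr (conj (F _)).
by apply: val_inj; rewrite /= /bump leq0n add1n subSS.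
Qed.

Lemma adjm_mxprod n (I J : finType) (W : 'I_n -> imx I J A) :
  adjm conj (mxprod W) = mxprod_rev (fun k => adjm conj (W k)).
Proof.
by apply/ffunP=> -[i j]; rewrite !ffunE conj_prod; apply: eq_bigr => k _; rewrite ffunE.
Qed.

Lemma adjm_mxprod_rev n (I J : finType) (W : 'I_n -> imx I J A) :
  adjm conj (mxprod_rev W) = mxprod (fun k => adjm conj (W k)).
Proof.
by apply/ffunP=> -[i j]; rewrite !ffunE conj_prod; apply: eq_bigr => k _; rewrite ffunE rev_ordK.
Qed.

Lemma unitarym_mxprod n (I J : finType) (W : 'I_n -> imx I J A) :
  (forall k, unitarym conj (W k)) -> unitarym conj (mxprod W).
Proof.
move=> uW; rewrite /unitarym adjm_mxprod.
by split; [apply: mxprod_mul_rev|apply: mxprod_rev_mul] => k; have [] := uW k.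
Qed.

Lemma unitarym_mxprod_rev n (I J : finType) (W : 'I_n -> imx I J A) :
  (forall k, unitarym conj (W k)) -> unitarym conj (mxprod_rev W).
Proof.
move=> uW; rewrite /unitarym adjm_mxprod_rev.
by split; [apply: mxprod_rev_mul|apply: mxprod_mul_rev] => k; have [] := uW k.
Qed.

End Conjugation.
End Products.

(** * Star homomorphisms and tensor products of C*-algebras *)

From mathcomp Require Import ring.
From mathcomp Require Import complex.
From mathcomp Require Import all_classical all_reals.
From mathcomp Require Import topology normedtype sequences.
Import Defs.

Import Order.TTheory GRing.Theory Num.Theory.
Import numFieldNormedType.Exports.
Local Open Scope classical_set_scope.

(** * Norm estimates and square roots in C*-algebras *)

Lemma complex_expr_small (R : realType) (r e : R[i]) :
  0 <= r -> r < 1 -> 0 < e -> exists N, r ^+ N < e.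
Proof.
move=> r0 r1 e0.
have rE : r = (complex.Re r)%:C%C by rewrite RRe_real // ger0_real.
have eE : e = (complex.Re e)%:C%C by rewrite RRe_real // gtr0_real.
move: r0 r1 e0; rewrite rE eE -(rmorph1 (real_complex R)) lecR !ltcR.
set rho := complex.Re r; set eps := complex.Re e => r0 r1 e0.
have /cvgrPdist_lt/(_ eps e0)[N _ /(_ N (leqnn N))] :
  ((GRing.exp rho : R ^nat) x @[x --> \oo] --> (0 : R)).
  by apply: cvg_expr; rewrite ger0_norm.
rewrite /= sub0r normrN ger0_norm ?exprn_ge0 // => h.
by exists N; rewrite -rmorphXn /= ltcR.
Qed.

Lemma ler_eps (R : realType) (x y : R[i]) : x \is Num.real -> y \is Num.real ->
  (forall e, 0 < e -> x <= y + e) -> x <= y.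
Proof.
move=> xr yr h; case: (real_leP xr yr) => // yx.
have := h ((x - y) / 2); rewrite divr_gt0 ?ltr0n ?subr_gt0 // => /(_ isT) h2.
have : x < x; last by rewrite ltxx.
apply: le_lt_trans h2 _; rewrite -ltrBrDl ltr_pdivrMr ?ltr0n // mulr_natr mulr2n.
by rewrite ltrDl subr_gt0.
Qed.

Section CStar.
Variables (R : realType) (A : cstarAlgType R).
Implicit Types a b c : A.

Lemma cnorm_ge0 a : 0 <= cnorm a.
Proof. exact: (@normr_ge0 _ (normed A) a). Qed.

Lemma cnorm0 : cnorm (0 : A) = 0.
Proof. exact: (@normr0 _ (normed A)). Qed.

Lemma cnorm_star a : cnorm (star a) = cnorm a.
Proof.
have le b : cnorm b <= cnorm (star b).
  have := cnorm_ge0 b; rewrite le_eqVlt => /orP[/eqP<-|b0]; first exact: cnorm_ge0.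
  by rewrite -(ler_pM2r b0) -expr2 -cnorm_starM cnormM.
by apply/eqP; rewrite eq_le le -{2}[a]starK le.
Qed.

Lemma starD a b : star (a + b) = star a + star b.
Proof. by rewrite -[a]scale1r star_semilinear rmorph1 !scale1r. Qed.

Lemma star0 : star (0 : A) = 0.
Proof. by apply: (addIr (star 0)); rewrite -starD !add0r. Qed.

Lemma starZ (k : R[i]) a : star (k *: a) = k^* *: star a.
Proof. by rewrite -[k *: a]addr0 star_semilinear star0 addr0. Qed.

Lemma starN a : star (- a) = - star a.
Proof. by rewrite -scaleN1r starZ rmorphN1 scaleN1r. Qed.

Lemma star1 : star (1 : A) = 1.
Proof. by rewrite -[LHS]mulr1 -{2}[1]starK -starM mulr1 starK. Qed.

Lemma star_sum I (r : seq I) (P : pred I) (F : I -> A) :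
  star (\sum_(i <- r | P i) F i) = \sum_(i <- r | P i) star (F i).
Proof. exact: (big_morph _ starD star0). Qed.

Lemma cnorm1_le : cnorm (1 : A) <= 1.
Proof.
have := cnorm_starM (1 : A); rewrite star1 mulr1 => h.
have := cnorm_ge0 (1 : A); rewrite le_eqVlt => /orP[/eqP<-|p0]; first exact: ler01.
by rewrite -(ler_pM2r p0) -expr2 -h mul1r.
Qed.

Lemma cnormN a : cnorm (- a) = cnorm a.
Proof. exact: (@normrN _ (normed A) a). Qed.

Lemma cnorm_small_eq0 (K : R[i]) a :
  0 <= K -> (forall e, 0 < e -> cnorm a <= K * e) -> a = 0.
Proof.
move=> K0 h; apply: cnorm_eq0; apply/eqP; rewrite eq_le cnorm_ge0 andbT.
apply: ler_eps => [||e e0]; [exact: ger0_real (cnorm_ge0 a)|exact: real0|].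
(* Dividing by [K + 1] covers the case [K = 0]. *)
have K1 : 0 < K + 1 by rewrite ltr_wpDl.
rewrite add0r (le_trans (h (e / (K + 1)) _)) ?divr_gt0 //.
by rewrite mulrCA ler_piMr ?(ltW e0) // ler_pdivrMr // mul1r lerDl.
Qed.

(* The fixed point y of y |-> (c + y ^+ 2) / 2, a contraction of the ball of
   radius r, satisfies (1 - y) ^+ 2 = 1 - c. *)
Lemma cstar_sqrt c (r : R[i]) : 0 <= r -> r < 1 -> cnorm c <= r ^+ 2 ->
  star c = c -> exists b, [/\ star b = b, b * b = 1 - c
    & forall a, a * c = c * a -> a * b = b * a].
Proof.
move=> r0 r1 cr sc.
pose f y : A := 2^-1 *: (c + y * y).
pose y n : A := iter n f 0.
have yr n : cnorm (y n) <= r.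
  elim: n => [|n IH]; first by rewrite cnorm0.
  rewrite /= -/(y n) /f cnormZ ger0_norm ?invr_ge0 ?ler0n //.
  rewrite ler_pdivrMl ?ltr0n // (le_trans (cnormD _ _)) //.
  rewrite mulr_natl mulr2n lerD //.
    by rewrite (le_trans cr) // expr2 ler_piMl // ltW.
  rewrite (le_trans (cnormM _ _)) //.
  apply: (@le_trans _ _ (r * r)); first by rewrite ler_pM ?cnorm_ge0.
  by rewrite ler_piMl // ltW.
have step u v : cnorm u <= r -> cnorm v <= r -> cnorm (f u - f v) <= r * cnorm (u - v).
  move=> ur vr; rewrite /f -scalerBr cnormZ ger0_norm ?invr_ge0 ?ler0n //.
  (* Difference of squares for elements that need not commute. *)
  have -> : c + u * u - (c + v * v) = u * (u - v) + (u - v) * v.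
    by rewrite opprD addrACA subrr add0r mulrBr mulrBl addrA subrK.
  rewrite ler_pdivrMl ?ltr0n // (le_trans (cnormD _ _)) //.
  rewrite mulr_natl mulr2n lerD // (le_trans (cnormM _ _)) //.
    by rewrite ler_wpM2r ?cnorm_ge0.
  by rewrite mulrC ler_wpM2r ?cnorm_ge0.
have d1 n : cnorm (y n.+1 - y n) <= r ^+ n * r.
  elim: n => [|n IH]; first by rewrite subr0 expr0 mul1r.
  apply: (le_trans (step _ _ (yr n.+1) (yr n))).
  by rewrite exprS -mulrA ler_wpM2l.
have r1' : 0 < 1 - r by rewrite subr_gt0.
(* The geometric series bound, multiplied by [1 - r] to avoid a division. *)
have dk n k : (1 - r) * cnorm (y (n + k)%N - y n) <= r ^+ n * (1 - r ^+ k).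
  elim: k => [|k IH]; first by rewrite addn0 subrr cnorm0 mulr0 expr0 subrr mulr0.
  have -> : y (n + k.+1)%N - y n = (y (n + k).+1 - y (n + k)%N) + (y (n + k)%N - y n).
    by rewrite addnS addrA subrK.
  apply: (@le_trans _ _ ((1 - r) * (r ^+ (n + k) * r + cnorm (y (n + k)%N - y n)))).
    apply: ler_wpM2l; first exact: ltW.
    by apply: le_trans (cnormD _ _) _; rewrite lerD2r; exact: d1.
  rewrite mulrDr; apply: (@le_trans _ _ ((1 - r) * (r ^+ (n + k) * r) + r ^+ n * (1 - r ^+ k))).
    by rewrite lerD2l.
  (* This is exactly the slack left in the induction step. *)
  have kr : r ^+ n * (r ^+ k * (1 - r) * (1 - r)) >= 0.
    by rewrite !mulr_ge0 ?exprn_ge0 // ltW.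
  rewrite -subr_ge0; move: kr; congr (0 <= _); rewrite exprD exprS; ring.
have [l yl] : exists l : normed A, ((y n : normed A) @[n --> \oo] --> l).
  suff cy : cauchy ((y n : normed A) @[n --> \oo]) by apply/cvg_ex; exact: cstar_complete.
  apply: cauchy_exP => e e0.
  have [N hN] := complex_expr_small r0 r1 (mulr_gt0 r1' e0).
  exists (y N); exists N => // k Nk; rewrite -ball_normE /ball_ /=.
  rewrite -[X in X < _]/(cnorm (y N - y k)) -cnormN opprB.
  rewrite -(ltr_pM2l r1') (le_lt_trans _ hN) //.
  have := dk N (k - N)%N; rewrite subnKC // => h.
  apply: le_trans h _; rewrite ler_piMr ?exprn_ge0 // lerBlDr lerDl exprn_ge0 //.
have ly e : 0 < e -> exists n, cnorm (l - y n) <= e /\ cnorm (l - y n.+1) <= e.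
  move=> e0; have /cvgrPdist_lt/(_ e e0)[n _ hn] := yl.
  by exists n; split; apply: ltW; apply: hn => /=.
have lr : cnorm (l : A) <= r.
  apply: ler_eps => [||e /ly[n [hn _]]]; rewrite ?ger0_real ?cnorm_ge0 //.
  by rewrite -[l : A](subrK (y n)) (le_trans (cnormD _ _)) // addrC lerD.
have fl : f l = l.
  apply/eqP; rewrite -subr_eq0; apply/eqP.
  apply: (@cnorm_small_eq0 2) => [|e /ly[n [h1 h2]]]; first exact: ler0n.
  have -> : f l - l = (f l - f (y n)) + - (l - f (y n)) by rewrite opprB addrA subrK.
  rewrite mulr_natl mulr2n (le_trans (cnormD _ _)) // lerD ?cnormN //.
  rewrite (le_trans (step _ _ lr (yr n))) //.
  by rewrite (le_trans _ h1) // ler_piMl ?cnorm_ge0 // ltW.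
have ys n : star (y n) = y n.
  elim: n => [|n IH]; first exact: star0.
  rewrite /= -/(y n) /f starZ starD sc starM IH.
  by rewrite fmorphV rmorph_nat.
have sl : star (l : A) = l.
  apply/eqP; rewrite -subr_eq0; apply/eqP.
  apply: (@cnorm_small_eq0 2) => [|e /ly[n [h1 h2]]]; first exact: ler0n.
  have -> : star (l : A) - l = star ((l : A) - y n) + - (l - y n).
    by rewrite starD starN ys opprB addrA subrK.
  by rewrite mulr_natl mulr2n (le_trans (cnormD _ _)) // lerD ?cnormN ?cnorm_star.
exists (1 - (l : A)); split.
- by rewrite starD starN star1 sl.
- have l2 : c + l * l = l + l.
    by rewrite -mulr2n -scaler_nat -[in RHS]fl /f scalerA mulfV ?pnatr_eq0 // scale1r.
  have -> : c = l + l - l * l by rewrite -l2 addrK.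
  by rewrite mulrBr mulr1 mulrBl mul1r !opprD !opprK !addrA.
- move=> a ac; rewrite mulrBr mulrBl mulr1 mul1r; congr (_ - _).
  have ya n : a * y n = y n * a.
    elim: n => [|n IH]; first by rewrite mulr0 mul0r.
    rewrite /= -/(y n) /f -scalerAr -scalerAl mulrDr mulrDl ac.
    by rewrite mulrA IH -mulrA IH mulrA.
  apply/eqP; rewrite -subr_eq0; apply/eqP.
  apply: (@cnorm_small_eq0 (cnorm a *+ 2)) => [|e /ly[n [h1 h2]]].
    by rewrite mulrn_wge0 ?cnorm_ge0.
  have -> : a * l - l * a = a * (l - y n) + - ((l - y n) * a).
    by rewrite mulrBr mulrBl opprB ya addrA subrK.
  rewrite mulr2n [leRHS]mulrDl (le_trans (cnormD _ _)) // cnormN.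
  rewrite lerD // (le_trans (cnormM _ _)) ?ler_wpM2l ?cnorm_ge0 //.
  by rewrite mulrC ler_wpM2l ?cnorm_ge0.
Qed.

End CStar.

(** * Contractivity of *-homomorphisms *)

Section Contractive.
Variables (R : realType) (A B : cstarAlgType R) (phi : {lrmorphism A -> B}).
Hypothesis phi_star : forall a, phi (star a) = star (phi a).

Lemma cstar_morphism_unitary (u : A) : star u * u = 1 -> cnorm (phi u) <= 1.
Proof.
move=> uu; rewrite -(@ler_pXn2r _ 2) ?nnegrE ?cnorm_ge0 ?ler01 //.
by rewrite -cnorm_starM -phi_star -rmorphM uu rmorph1 expr1n cnorm1_le.
Qed.

(* A self-adjoint contraction a is the real part of the unitary a + i b, where
   b ^+ 2 = 1 - a ^+ 2. *)
Lemma cstar_morphism_selfadjoint1 (a : A) :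
  star a = a -> cnorm a < 1 -> cnorm (phi a) <= 1.
Proof.
move=> sa a1; have a0 := cnorm_ge0 a.
have [||b [sb bb ab]] := @cstar_sqrt R A (a * a) (cnorm a) a0 a1.
- by rewrite expr2 cnormM.
- by rewrite starM sa.
have {}ab : a * b = b * a by apply: ab; rewrite mulrA.
have uu (k : R[i]) : k * k = -1 -> (a - k *: b) * (a + k *: b) = 1.
  move=> k2; rewrite mulrBl !mulrDr -!scalerAl -!scalerAr scalerA k2 scaleN1r bb ab.
  by rewrite opprD opprK addrA addrK addrC subrK.
have su (k : R[i]) : k^* = - k -> star (a + k *: b) = a - k *: b.
  by move=> ck; rewrite starD starZ sa sb ck scaleNr.
have i2 : 'i * 'i = -1 :> R[i] by rewrite -expr2 sqrCi.
have iC : ('i)^* = - 'i :> R[i] by rewrite conjCi.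
have h1 := cstar_morphism_unitary (etrans (congr1 (fun x => x * _) (su _ iC)) (uu _ i2)).
have h2 : cnorm (phi (a + (- 'i) *: b)) <= 1.
  apply: cstar_morphism_unitary; rewrite su ?uu ?mulrNN //.
  by rewrite rmorphN /= iC.
have -> : a = 2^-1 *: ((a + 'i *: b) + (a + (- 'i) *: b)).
  have a2 : a + a = 2 *: a by rewrite scaler_nat mulr2n.
  by rewrite addrACA scaleNr subrr addr0 a2 scalerA mulVf ?pnatr_eq0 // scale1r.
rewrite linearZ cnormZ ger0_norm ?invr_ge0 ?ler0n //= ler_pdivrMl ?ltr0n //.
by rewrite rmorphD mulr1 (le_trans (cnormD _ _)) // lerD.
Qed.

Lemma cstar_morphism_selfadjoint (a : A) : star a = a -> cnorm (phi a) <= cnorm a.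
Proof.
move=> sa; apply: ler_eps => [||e e0]; rewrite ?ger0_real ?cnorm_ge0 //.
(* Dividing by [t] moves [a] into the open unit ball, where the square root is available; [e] is
   arbitrary. *)
set t := cnorm a + e.
have t0 : 0 < t by rewrite ltr_wpDl ?cnorm_ge0.
have tn : `|t^-1| = t^-1 by rewrite ger0_norm // invr_ge0 ltW.
have tC : (t^-1)^* = t^-1 by apply: CrealP; rewrite ger0_real // invr_ge0 ltW.
have := @cstar_morphism_selfadjoint1 (t^-1 *: a).
rewrite starZ tC sa => /(_ erefl); rewrite linearZ !cnormZ tn.
rewrite ltr_pdivrMl // mulr1 ltrDl e0 => /(_ isT).
by rewrite ler_pdivrMl // mulr1.
Qed.

(** The C*-identity on both sides reduces the claim to the self-adjoint element [star a * a]. *)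
Lemma cstar_morphism_contractive (a : A) : cnorm (phi a) <= cnorm a.
Proof.
rewrite -(@ler_pXn2r _ 2) ?nnegrE ?cnorm_ge0 // -!cnorm_starM -phi_star -rmorphM.
by apply: cstar_morphism_selfadjoint; rewrite starM starK.
Qed.

Lemma cstar_morphism_continuous : continuous (phi : normed A -> normed B).
Proof.
pose f (a : normed A) : normed B := phi (a : A).
rewrite -[X in continuous X]/f => a.
apply/(@cvgrPdist_lt _ (normed B) (normed A) _ (nbhs_filter a) f (f a)) => e e0.
apply/nbhs_ballP; exists e => //= b.
rewrite -ball_normE /ball_ /=; apply: le_lt_trans.
rewrite -[X in X <= _]/(cnorm (phi a - phi b)) -rmorphB.
exact: cstar_morphism_contractive.
Qed.

(** Contractivity makes the preimage closed. Consequently [phi] maps a generated C*-subalgebra into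
    [S] as soon as it maps the generators there. *)
Lemma cstar_closed_preimage (S : set B) : cstar_closed S -> cstar_closed (phi @^-1` S).
Proof.
move=> [cS [S1 lS mS] sS]; split.
- apply: (@closed_comp _ _ (phi : normed A -> normed B)) => // a _.
  exact: cstar_morphism_continuous.
- split.
  + by apply/mem_set; rewrite /preimage /= rmorph1; apply/set_mem.
  + move=> k u v /set_mem hu /set_mem hv; apply/mem_set; rewrite /preimage /= linearP.
    by apply/set_mem/lS; apply/mem_set.
  + move=> u v /set_mem hu /set_mem hv; apply/mem_set; rewrite /preimage /= rmorphM.
    by apply/set_mem/mS; apply/mem_set.
- by move=> a; rewrite /preimage /= phi_star; exact: sS.
Qed.

End Contractive.

(** * C*-subalgebras and closed spans *)

Section CStarSubTheory.
Variables (R : realType) (A : cstarAlgType R) (X : set A).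

Lemma cstar_sub_closure (S : set (normed (cstar_sub X))) (s : cstar_sub X) :
  closure ([set \val t | t in S] : set (normed A)) (\val s) -> closure S s.
Proof.
move=> h B /nbhs_ballP[e /= e0 eB].
have [_ [[t St <-] hb]] := h _ (nbhsx_ballx (\val s : normed A) e e0).
exists t; split=> //; apply: eB.
by move: hb; rewrite -!ball_normE.
Qed.

(** A limit in [A] of elements of [S] stays in the generated subalgebra, which is closed, and there
    the closedness of [S] applies. *)
Lemma cstar_sub_closed_image (S : set (cstar_sub X)) :
  cstar_closed S -> cstar_closed [set \val s | s in S].
Proof.
move=> [cS [S1 lS mS] sS]; split.
- move=> a ha.
  have Xa : cstar_gen X a.
    have [cX _ _] := cstar_genP X; apply: cX => B /ha[_ [[s Ss <-] Bs]].
    by exists (\val s); split=> //; exact: cstar_sub_valP.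
  exists (CStarSub (introT (cstar_gen_predP X a) Xa)) => //.
  by apply/cS/cstar_sub_closure.
- split.
  + by apply/mem_set; exists 1 => //; apply/set_mem.
  + move=> k u v /set_mem[s Ss <-] /set_mem[t St <-]; apply/mem_set.
    by exists (k *: s + t) => //; apply/set_mem/lS; apply/mem_set.
  + move=> u v /set_mem[s Ss <-] /set_mem[t St <-]; apply/mem_set.
    by exists (s * t) => //; apply/set_mem/mS; apply/mem_set.
- by move=> _ [s Ss <-]; exists (star s) => //; exact: sS.
Qed.

(** An induction principle: the image of [S] in [A] is C*-closed and contains [X], hence contains
    everything generated by [X]. *)
Lemma cstar_sub_ind (S : set (cstar_sub X)) : cstar_closed S ->
  (forall s, X (\val s) -> S s) -> S = setT.
Proof.
move=> cS XS; apply/seteqP; split=> // s _.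
have [t St /val_inj <-//] := @cstar_sub_valP _ _ _ s _
  (conj (cstar_sub_closed_image cS) (fun a Xa =>
     let s := CStarSub (introT (cstar_gen_predP X a) (sub_gen_smallest Xa)) in
     ex_intro2 _ _ s (XS s Xa) erefl)).
Qed.

End CStarSubTheory.

Section LinSpan.
Variables (K : pzRingType) (V : lmodType K).
Implicit Types X S : set V.

Lemma lin_span_ind X S : S 0 -> (forall k v w, X v -> S w -> S (k *: v + w)) ->
  lin_span X `<=` S.
Proof.
move=> S0 SX _ [s [hs ->]]; elim: s hs => [|c s IH] hs; rewrite ?big_nil ?big_cons //.
by apply: SX; [apply: hs; rewrite mem_head|apply: IH => d ds; apply: hs; rewrite inE ds orbT].
Qed.

Lemma lin_span0 X : lin_span X 0.
Proof. by exists [::]; rewrite big_nil. Qed.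

Lemma lin_spanZD X k v w : X v -> lin_span X w -> lin_span X (k *: v + w).
Proof.
move=> Xv [s [hs ->]]; exists ((k, v) :: s); rewrite big_cons; split=> // c.
by rewrite inE => /orP[/eqP->//|/hs].
Qed.

Lemma sub_lin_span X : X `<=` lin_span X.
Proof.
move=> v Xv; rewrite -[v]addr0 -[v]scale1r.
by apply: lin_spanZD => //; exact: lin_span0.
Qed.

Lemma lin_span_linear X k v w : lin_span X v -> lin_span X w -> lin_span X (k *: v + w).
Proof.
move=> hv hw; apply: (@lin_span_ind X (fun v => lin_span X (k *: v + w))) hv => //.
  by rewrite scaler0 add0r.
move=> l a b Xa hb; rewrite scalerDr scalerA -addrA; exact: lin_spanZD.
Qed.

End LinSpan.

Lemma closure_normP (K : numFieldType) (V : normedModType K) (S : set V) v :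
  closure S v <-> forall e, 0 < e -> exists2 w, S w & `|v - w| < e.
Proof.
split=> [h e e0|h B /nbhs_ballP[e /= e0 eB]].
  have [w [Sw hw]] := h _ (nbhsx_ballx v e e0).
  by exists w => //; move: hw; rewrite -ball_normE.
by have [w Sw hw] := h e e0; exists w; split=> //; apply: eB; rewrite -ball_normE.
Qed.

Section ClosureAlgebra.
Variables (R : realType) (A : cstarAlgType R).
Implicit Types S Y : set (normed A).

Lemma closure_lipschitz S S' (f : A -> A) (k : R[i]) : 0 <= k ->
  (forall a b, cnorm (f a - f b) <= k * cnorm (a - b)) ->
  (forall a, S a -> closure S' (f a)) -> forall a, closure S a -> closure S' (f a).
Proof.
move=> k0 fk fS a /closure_normP Sa.
have -> : closure S' = closure (closure S') by apply/closure_id/closed_closure.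
apply/closure_normP => e e0.
have k1 : 0 < k + 1 by rewrite ltr_wpDl.
have [b Sb hb] := Sa (e / (k + 1)) (divr_gt0 e0 k1).
exists (f b); first exact: fS.
apply: le_lt_trans (fk a b) _; apply: (@le_lt_trans _ _ ((k + 1) * cnorm (a - b))).
  by rewrite ler_wpM2r ?cnorm_ge0 // lerDl.
by rewrite -ltr_pdivlMl // mulrC.
Qed.

(** The span of a self-adjoint monoid is a *-algebra. Each operation then passes to the closure one
    variable at a time, being Lipschitz in either variable when the other is fixed. *)
Lemma cstar_closed_closure_span Y : Y (1 : A) ->
  (forall a b : A, Y a -> Y b -> Y (a * b)) -> (forall a : A, Y a -> Y (star a)) ->
  cstar_closed (closure (lin_span Y : set (normed A)) : set A).
Proof.
move=> Y1 YM Ys; set S : set (normed A) := lin_span Y.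
have SM (a b : A) : S a -> S b -> S (a * b).
  move=> Sa Sb; apply: (@lin_span_ind _ A Y (fun a => S (a * b))) Sa => [|k v w Yv hw].
    by rewrite mul0r; exact: lin_span0.
  rewrite mulrDl -scalerAl; apply: (@lin_span_linear _ A) hw.
  apply: (@lin_span_ind _ A Y (fun b => S (v * b))) Sb => [|l c d Yc hd].
    by rewrite mulr0; exact: lin_span0.
  by rewrite mulrDr -scalerAr; apply: (@lin_spanZD _ A) => //; exact: YM.
have Ss (a : A) : S a -> S (star a).
  apply: (@lin_span_ind _ A Y (fun a => S (star a))) => [|k v w Yv hw].
    by rewrite star0; exact: lin_span0.
  by rewrite star_semilinear; apply: (@lin_spanZD _ A) => //; exact: Ys.
have sub := @subset_closure _ S.
have MR (b : A) : S b -> forall a : A, closure S a -> closure S (a * b).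
  move=> Sb; apply: (@closure_lipschitz S S (fun a => a * b) (cnorm b)).
  - exact: cnorm_ge0.
  - by move=> a c; rewrite -mulrBl mulrC cnormM.
  - by move=> a Sa; apply/sub/SM.
have M (a b : A) : closure S a -> closure S b -> closure S (a * b).
  move=> Sa; apply: (@closure_lipschitz S S (fun b => a * b) (cnorm a)).
  - exact: cnorm_ge0.
  - by move=> c d; rewrite -mulrBr cnormM.
  - by move=> c Sc; exact: MR.
have LS (k : R[i]) (b : A) : S b -> forall a : A, closure S a -> closure S (k *: a + b).
  move=> Sb; apply: (@closure_lipschitz S S (fun a => k *: a + b) `|k|) => //.
  - by move=> a c; rewrite opprD addrACA subrr addr0 -scalerBr cnormZ.
  - by move=> a Sa; apply/sub/(@lin_span_linear _ A).
split.
- exact: closed_closure.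
- split.
  + by apply/mem_set/sub/sub_lin_span.
  + move=> k u v /set_mem hu /set_mem hv; apply/mem_set.
    apply: (@closure_lipschitz S S (fun b => k *: u + b) 1) hv => // [a c|b Sb].
      by rewrite opprD addrACA subrr add0r mul1r.
    exact: LS.
  + by move=> u v /set_mem hu /set_mem hv; apply/mem_set/M.
- apply: (@closure_lipschitz S S star 1) => // [a b|a Sa].
    by rewrite -starN -starD cnorm_star mul1r.
  by apply/sub/Ss.
Qed.

End ClosureAlgebra.

Lemma dense_linear_ext (K : numFieldType) (V W : normedModType K) (Z : set V)
    (f g : V -> W) : continuous f -> continuous g -> linear f -> linear g ->
  closure (lin_span Z) = setT -> (forall z, Z z -> f z = g z) -> f =1 g.
Proof.
move=> cf cg lf lg dZ e z.
have f0 (h : V -> W) : linear h -> h 0 = 0.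
  by move=> lh; have := lh (-1) 0 0; rewrite !scaleN1r !addNr.
have : closure (lin_span Z) z by rewrite dZ.
have cE : closed [set z | (f \- g) z = 0].
  apply: (@closed_comp _ _ (f \- g) [set 0]) => [v _|];
    last exact/accessible_closed_set1/hausdorff_accessible/norm_hausdorff.
  by apply: cvgB; [exact: cf|exact: cg].
move/(closure_subset (B := [set z | (f \- g) z = 0])) => h.
apply/eqP; rewrite -subr_eq0; apply/eqP; apply: cE; apply: h.
apply: lin_span_ind => [|k v w Zv] /=; first by rewrite !f0 // subrr.
by move=> hw; rewrite lf lg (e v Zv) opprD addrACA subrr add0r.
Qed.

(** * Spatial tensor products *)

Lemma dot0l (R : realType) (H : hilbertType R) (x : H) : dot 0 x = 0.
Proof. by have := dot_linear (-1) 0 0 x; rewrite scaleN1r addNr mulN1r addNr. Qed.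

(* By Pythagoras, a vector orthogonal to the span is at distance at least its
   norm from it. *)
Lemma dense_orthogonal_eq0 (R : realType) (H : hilbertType R) (Z : set H) (v : H) :
  closure (lin_span Z) = setT -> (forall z, Z z -> dot z v = 0) -> v = 0.
Proof.
move=> dZ ov.
have ov' w : lin_span Z w -> dot w v = 0.
  apply: (@lin_span_ind _ H Z (fun w => dot w v = 0)) => [|k x y Zx hy]; first exact: dot0l.
  by rewrite dot_linear ov // mulr0 add0r.
apply/normr0_eq0/eqP; rewrite eq_le normr_ge0 andbT.
apply: ler_eps => [||e e0]; rewrite ?normr_real //.
have : closure (lin_span Z) v by rewrite dZ.
move=> /closure_normP/(_ e e0)[w /ov' wv] /ltW h; rewrite add0r; apply: le_trans h.
rewrite -(@ler_pXn2r _ 2) ?nnegrE ?normr_ge0 // -!dot_norm.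
have vw : dot v w = 0 by rewrite dotC wv conjC0.
have expand_sub (x : H) : dot (v - w) x = dot v x - dot w x.
  by rewrite addrC -scaleN1r dot_linear mulN1r addrC.
have -> : dot (v - w) (v - w) = dot v v + dot w w.
  rewrite expand_sub dotC [dot w _]dotC !expand_sub vw wv subr0 sub0r rmorphN /= opprK.
  by rewrite -!dotC.
by rewrite lerDl dot_norm exprn_ge0.
Qed.

(** The difference acts as zero, so the minimality of the operator norm applies with the bound 0. *)
Lemma isometric_inj (R : realType) (T : cstarAlgType R) (H : hilbertType R)
    (rho : T -> H -> H) s s' : star_representation rho -> isometric rho ->
  rho s =1 rho s' -> s = s'.
Proof.
move=> rP iP e; apply/eqP; rewrite -subr_eq0; apply/eqP/cnorm_eq0/eqP.
rewrite eq_le cnorm_ge0 andbT; apply: (iP _).2 => // x.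
rewrite mul0r -scaleN1r addrC (rep_linear rP) e scaleN1r addNr normr0 //.
Qed.

Section SpatialTensorTheory.
Variables (R : realType) (A B T : cstarAlgType R) (tens : A -> B -> T).
Hypothesis tensP : spatial_tensor tens.

(** [spatial_tensor] describes [tens] only through its operators. Algebraic identities follow
    because both sides act alike on elementary tensors of vectors, whose span is dense, and [rho] is
    injective. *)
Lemma spatial_tensorM a a' b b' : tens a b * tens a' b' = tens (a * a') (b * b').
Proof.
have [H1 [H2 [K [t [pi1 [pi2 [rho [tP [r1 _] [r2 _] [r i] [e _]]]]]]]]] := tensP.
have [_ _ _ dt] := tP.
apply: (isometric_inj r i); apply: (dense_linear_ext _ _ _ _ dt);
  do ?[exact: rep_operator_continuous|exact: rep_operator_linear].
by move=> _ [x [y ->]]; rewrite (rep_mul r) !e (rep_mul r1) (rep_mul r2).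
Qed.

Lemma spatial_tensor1 : tens 1 1 = 1.
Proof.
have [H1 [H2 [K [t [pi1 [pi2 [rho [tP [r1 _] [r2 _] [r i] [e _]]]]]]]]] := tensP.
have [_ _ _ dt] := tP.
apply: (isometric_inj r i); apply: (dense_linear_ext _ _ _ _ dt);
  do ?[exact: rep_operator_continuous|exact: rep_operator_linear].
by move=> _ [x [y ->]]; rewrite !e (rep_one r) (rep_one r1) (rep_one r2).
Qed.

Lemma spatial_tensor_star a b : star (tens a b) = tens (star a) (star b).
Proof.
have [H1 [H2 [K [t [pi1 [pi2 [rho [tP [r1 _] [r2 _] [r i] [e _]]]]]]]]] := tensP.
have [_ _ dt2 dt] := tP.
apply: (isometric_inj r i); apply: (dense_linear_ext _ _ _ _ dt);
  do ?[exact: rep_operator_continuous|exact: rep_operator_linear].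
(* An adjoint is known only through inner products, so the difference is shown to be orthogonal to
   all elementary tensors. *)
move=> _ [x [y ->]]; apply/eqP; rewrite -subr_eq0; apply/eqP.
apply: (dense_orthogonal_eq0 dt) => _ [x' [y' ->]].
rewrite dotC -scaleN1r addrC dot_linear (rep_star r (star _)) starK !e !dt2.
by rewrite (rep_star r1) (rep_star r2) !starK mulN1r addNr conjC0.
Qed.

Variables (X : set A) (Y : set B).

Let W : set T := [set s | exists a b, [/\ cstar_gen X a, cstar_gen Y b & s = tens a b]].

Lemma tens_sub_subproof (a : cstar_sub X) (b : cstar_sub Y) :
  tens (\val a) (\val b) \in cstar_gen_pred W.
Proof.
apply: (introT (cstar_gen_predP _ _)); apply: sub_gen_smallest.
by exists (\val a), (\val b); split=> //; exact: cstar_sub_valP.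
Qed.

Definition tens_sub (a : cstar_sub X) (b : cstar_sub Y) : cstar_sub W :=
  CStarSub (tens_sub_subproof a b).

Lemma star_representation_sub (C : cstarAlgType R) (Z : set C) (H : hilbertType R)
    (pi : C -> H -> H) :
  star_representation pi -> star_representation (fun c : cstar_sub Z => pi (\val c)).
Proof.
move=> r; split=> *; [exact: rep_operator_linear|exact: rep_operator_continuous
  |exact: rep_linear|exact: rep_one|exact: rep_mul|exact: rep_star].
Qed.

(** The Hilbert spaces are kept and the representations restricted, which preserves faithfulness and
    isometry. What remains is density: elementary tensors form a self-adjoint monoid, so the closure
    of their span is C*-closed and contains the generators. *)
Lemma spatial_tensor_sub : spatial_tensor tens_sub.
Proof.
have M := spatial_tensorM; have one := spatial_tensor1; have st := spatial_tensor_star.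
have [H1 [H2 [K [t [pi1 [pi2 [rho [tP [r1 f1] [r2 f2] [r i] [e _]]]]]]]]] := tensP.
exists H1, H2, K, t, (fun c : cstar_sub X => pi1 (\val c)),
  (fun c : cstar_sub Y => pi2 (\val c)), (fun c : cstar_sub W => rho (\val c)).
split=> //.
- by split; [exact: star_representation_sub|move=> a /f1 a0; exact: val_inj].
- by split; [exact: star_representation_sub|move=> a /f2 a0; exact: val_inj].
- by split; [exact: star_representation_sub|move=> s; exact: i].
split; first by move=> a b x y; exact: e.
apply: cstar_sub_ind.
  apply: cstar_closed_closure_span.
  - by exists 1, 1; apply: val_inj; rewrite /= one.
  - move=> _ _ [a [b ->]] [a' [b' ->]]; exists (a * a'), (b * b').
    by apply: val_inj; rewrite /= M.
  - move=> _ [a [b ->]]; exists (star a), (star b).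
    by apply: val_inj; rewrite /= -st.
move=> s [a [b [Xa Yb sE]]]; apply/subset_closure/sub_lin_span.
exists (CStarSub (introT (cstar_gen_predP _ _) Xa)), (CStarSub (introT (cstar_gen_predP _ _) Yb)).
exact: val_inj.
Qed.

End SpatialTensorTheory.

(** * Conjugate representations *)

Lemma part_matrixE (K : pzRingType) m (n : 'I_m -> nat) x y (p : blocks m x y) i j :
  exists2 b : bool, part_matrix K n p (i, j) = b%:R &
    (b <-> constant_on p (point_label i j)).
Proof.
exists [forall B in p, forall a in B, forall b in B, point_label i j a == point_label i j b].
  by rewrite ffunE.
split=> [/forall_inP h B a b pB Ba Bb|h].
  by apply/eqP; move/forall_inP: (h B pB) => /(_ a Ba)/forall_inP; apply.
by do 3![apply/forall_inP => ? ?]; apply/eqP; apply: h; eassumption.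
Qed.

Lemma eq_part_matrix (K : pzRingType) m m' (n : 'I_m -> nat) (n' : 'I_m' -> nat) x y x' y'
    (p : blocks m x y) (q : blocks m' x' y') i j i' j' :
  (constant_on p (point_label i j) <-> constant_on q (point_label i' j')) ->
  part_matrix K n p (i, j) = part_matrix K n' q (i', j').
Proof.
move=> e; have [b -> hb] := part_matrixE K (n := n) p i j.
have [b' -> hb'] := part_matrixE K (n := n') q i' j'; congr (nat_of_bool _)%:R.
by apply/idP/idP; rewrite ?hb ?hb' => /e.
Qed.

Section FieldMatrices.
Variable K : fieldType.

Lemma sum_ffun0 (V : nmodType) (J : finType) (G : {ffun 'I_0 -> J} -> V) g :
  \sum_f G f = G g.
Proof.
rewrite (eq_bigr (fun=> G g)) => [|f _]; last by congr G; apply/ffunP => -[].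
by rewrite sumr_const card_ffun card_ord expn0.
Qed.

Definition ffun2 (J : Type) (a b : J) : {ffun 'I_2 -> J} :=
  [ffun k => if val k is 0%N then a else b].

Lemma sum_ffun2 (V : nmodType) (J : finType) (G : {ffun 'I_2 -> J} -> V) :
  \sum_f G f = \sum_a \sum_b G (ffun2 a b).
Proof.
rewrite pair_big /= (reindex (fun ab : J * J => ffun2 ab.1 ab.2)) //; apply: onW_bij.
exists (fun f : {ffun 'I_2 -> J} => (f ord0, f ord_max)) => [[a b]|f].
  by rewrite /= !ffunE.
apply/ffunP=> k; rewrite ffunE /=; case: k => -[|[|//]] h /=; congr (f _);
  exact: val_inj.
Qed.

(** Rescaling the columns of [Y] gives a right inverse of [X], rescaling its rows a left inverse,
    and the two coincide. *)
Lemma invertible_diag (I : finType) (X Y : imx I I K) (d d' : I -> K) :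
  (forall i, d i != 0) -> (forall i, d' i != 0) ->
  (forall i j, mulm X Y (i, j) = d i *+ (i == j)) ->
  (forall i j, mulm Y X (i, j) = d' i *+ (i == j)) -> invertible X.
Proof.
move=> d0 d'0 XY YX.
pose Z : imx I I K := [ffun ij => Y ij / d ij.2].
pose Z' : imx I I K := [ffun ij => (d' ij.1)^-1 * Y ij].
have XZ : mulm X Z = idm K I.
  apply/ffunP=> -[i j]; rewrite mulmE idmE.
  transitivity (mulm X Y (i, j) / d j).
    by rewrite mulmE mulr_suml; apply: eq_bigr => k _; rewrite ffunE mulrA.
  rewrite XY; case: eqP => [->|_]; first by rewrite mulr1n divff.
  by rewrite mulr0n mul0r.
have ZX : mulm Z' X = idm K I.
  apply/ffunP=> -[i j]; rewrite mulmE idmE.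
  transitivity ((d' i)^-1 * mulm Y X (i, j)).
    by rewrite mulmE mulr_sumr; apply: eq_bigr => k _; rewrite ffunE mulrA.
  rewrite YX; case: eqP => [_|_]; first by rewrite mulr1n mulVf.
  by rewrite mulr0n mulr0.
exists Z; split=> //; suff -> : Z = Z' by [].
by rewrite -[Z]mul1m -ZX -mulmA XZ mulm1.
Qed.

End FieldMatrices.

(** * Cups as invertible matrices *)

Section Cups.
Variables (R : realType) (m : nat) (n : 'I_m -> nat).
Notation M := (multi_index n).
Let labels (a : M) : 'I_m -> nat := fun l => a l.

(** The vector T_r in the tensor square, reshaped into a matrix: its two lower indices become row
    and column. *)
Definition cup_mx c (r : blocks m [::] [:: c; flip_colour c]) : imx M M R[i] :=
  [ffun ab => part_matrix R[i] n r
    (ffun2 ab.1 ab.2 : {ffun 'I_(size [:: c; flip_colour c]) -> M},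
     [ffun=> ab.1] : {ffun 'I_(size [::]) -> M})].

Lemma cup_mxE c (r : blocks m [::] [:: c; flip_colour c]) a b :
  exists2 t : bool, cup_mx r (a, b) = t%:R & (t <-> cup_rel r (labels a) (labels b)).
Proof.
have [t tE tP] := part_matrixE R[i] (n := n) r
  (ffun2 a b : {ffun 'I_(size [:: c; flip_colour c]) -> M})
  ([ffun=> a] : {ffun 'I_(size [::]) -> M}).
exists t; first by rewrite ffunE.
rewrite tP; apply: eq_constant_on => -[[[]//|[[|[|//]] h]] l];
  by rewrite /point_label /labelling /= ffunE.
Qed.

(** The entry at [a], [b] counts the indices [beta] that link [a] to [b] through the two cups. The
    conjugate equation excludes them for [a] and [b] distinct and provides at least one on the
    diagonal. The bound [beta l < n l] makes [beta] an index of the matrices. *)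
Lemma cup_mx_diag c (r : blocks m [::] [:: c; flip_colour c])
    d (s : blocks m [::] [:: d; flip_colour d]) :
  (forall a b, (exists beta, [/\ forall l, (beta l < n l)%N, cup_rel r (labels a) beta
     & cup_rel s beta (labels b)]) <-> labels a =1 labels b) ->
  exists2 e : M -> R[i], forall a, e a != 0
    & forall a b, mulm (cup_mx r) (cup_mx s) (a, b) = e a *+ (a == b).
Proof.
move=> h; exists (fun a => mulm (cup_mx r) (cup_mx s) (a, a)) => [a|a b].
  have [beta [bn hr hs]] := iffRL (h a a) (fun _ => erefl).
  pose b : M := [ffun l => Ordinal (bn l)].
  have lb : beta =1 labels b by move=> l; rewrite /labels ffunE.
  rewrite mulmE (bigD1 b) //=.
  have [t -> tP] := cup_mxE r a b; have [t' -> tP'] := cup_mxE s b a.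
  have -> : t by apply/tP; move: hr; apply: iffLR; apply: eq_cup_rel.
  have -> : t' by apply/tP'; move: hs; apply: iffLR; apply: eq_cup_rel.
  rewrite mulr1 gt_eqF // ltr_pwDl // sumr_ge0 // => k _.
  by have [? -> _] := cup_mxE r a k; have [? -> _] := cup_mxE s k a; rewrite mulr_ge0.
case: eqP => [->|ab]; first by rewrite mulr1n.
rewrite mulr0n mulmE big1 // => k _.
have [t -> tP] := cup_mxE r a k; have [t' -> tP'] := cup_mxE s k b.
rewrite -natrM mulnb; case: (boolP (t && t')) => // /andP[/tP hr /tP' hs].
case: ab; apply/ffunP=> l; apply: val_inj; apply: (iffLR (h a b) _ l).
by exists (labels k); split=> // l'; exact: ltn_ord.
Qed.

End Cups.

Section CupOperator.
Variables (R : realType) (I : finType) (m : nat) (n : 'I_m -> nat).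
Notation M := (multi_index n).
Variable Q : imx I M R[i].
Notation cj := (fun c : R[i] => c^*).

Definition colour_mx (c : colour) : imx I M R[i] := colour_case Q (conjm cj Q) c.

Lemma colour_mx_flip c i a : colour_mx (flip_colour c) (i, a) = (colour_mx c (i, a))^*.
Proof. by case: c; rewrite /= !ffunE ?conjCK. Qed.

Lemma adjm_colour c : colour_case (adjm cj Q) (conjm cj (adjm cj Q)) c
  = adjm cj (colour_mx c).
Proof. by case: c => //; apply/ffunP=> -[i a]; rewrite !ffunE. Qed.

Lemma conj_sum (J : finType) (F : J -> R[i]) : (\sum_j F j)^* = \sum_j (F j)^*.
Proof. exact: rmorph_sum. Qed.

Lemma unitarym_colour : unitarym cj Q -> forall c, unitarym cj (colour_mx c).
Proof.
move=> [QQ' Q'Q] [//|]; split; apply/ffunP=> -[i j]; rewrite mulmE idmE.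
  move/ffunP/(_ (i, j)): QQ'; rewrite mulmE idmE => /(congr1 cj).
  rewrite conjC_nat conj_sum => <-; apply: eq_bigr => k _.
  by rewrite !ffunE rmorphM.
move/ffunP/(_ (i, j)): Q'Q; rewrite mulmE idmE => /(congr1 cj).
rewrite conjC_nat conj_sum => <-; apply: eq_bigr => k _.
by rewrite !ffunE rmorphM.
Qed.

(** Transporting the cup by Q applies [colour_mx c] to its first leg and the conjugate matrix to its
    second. On the reshaped matrix this is conjugation by a unitary. *)
Definition cup_op c (r : blocks m [::] [:: c; flip_colour c]) : imx I I R[i] :=
  mulm (mulm (colour_mx c) (cup_mx R n r)) (adjm cj (colour_mx c)).

Lemma part_operator_cup c (r : blocks m [::] [:: c; flip_colour c])
    (f : {ffun 'I_(size [:: c; flip_colour c]) -> I}) g :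
  part_operator Q r (f, g) = cup_op r (f ord0, f ord_max).
Proof.
rewrite /part_operator mulmE.
rewrite (sum_ffun0 _ (ffun0 (card_ord 0) : {ffun 'I_0 -> M})) [word_power _ _ _]ffunE.
rewrite big_ord0 mulr1 mulmE (@sum_ffun2 _ M) /cup_op mulmE exchange_big /=.
apply: eq_bigr => b _; rewrite mulmE mulr_suml; apply: eq_bigr => a _.
have -> : part_matrix R[i] n r (ffun2 a b : {ffun 'I_(size [:: c; flip_colour c]) -> M},
    ffun0 (card_ord 0) : {ffun 'I_0 -> M}) = cup_mx R n r (a, b).
  rewrite [RHS]ffunE; apply: eq_part_matrix; apply: eq_constant_on => -[[[]//|k] l].
  by rewrite /point_label.
have -> : word_power (colour_case Q (conjm cj Q)) [:: c; flip_colour c] (f, ffun2 a b)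
    = colour_mx c (f ord0, a) * colour_mx (flip_colour c) (f ord_max, b).
  have e : lift ord0 ord0 = ord_max :> 'I_2 by exact: val_inj.
  by rewrite ffunE /= big_ord_recl big_ord1 /= e /ffun2 !ffunE.
by rewrite [adjm _ _ _]ffunE colour_mx_flip /= mulrAC.
Qed.

Lemma invertible_cup_op c (r : blocks m [::] [:: c; flip_colour c])
    (s : blocks m [::] [:: flip_colour c; flip_colour (flip_colour c)]) :
  unitarym cj Q ->
  (forall a b : M, (exists beta, [/\ forall l, (beta l < n l)%N,
      cup_rel r (fun l => a l) beta & cup_rel s beta (fun l => b l)]) <->
    (fun l => a l : nat) =1 (fun l => b l : nat)) ->
  (forall a b : M, (exists beta, [/\ forall l, (beta l < n l)%N,
      cup_rel s (fun l => a l) beta & cup_rel r beta (fun l => b l)]) <->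
    (fun l => a l : nat) =1 (fun l => b l : nat)) ->
  invertible (cup_op r).
Proof.
move=> uQ rs sr; have [U1 U2] := unitarym_colour uQ c.
have [e e0 he] := cup_mx_diag R rs; have [e' e'0 he'] := cup_mx_diag R sr.
have [X [h1 h2]] := invertible_diag e0 e'0 he he'.
exists (mulm (mulm (colour_mx c) X) (adjm cj (colour_mx c))); rewrite /cup_op; split.
  rewrite mulmA -(mulmA _ (adjm _ _)) (mulmA (adjm _ _)) U2 mul1m.
  by rewrite -(mulmA (colour_mx c)) h1 mulm1.
rewrite mulmA -(mulmA _ (adjm _ _)) (mulmA (adjm _ _)) U2 mul1m.
by rewrite -(mulmA (colour_mx c)) h2 mulm1.
Qed.

End CupOperator.

(** * Scalar equivalence with the conjugate *)

Section ConjugateEquivalence.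
Variables (R : realType) (A : cstarAlgType R) (I : finType).
Implicit Types v w u : imx I I A.

(** In matrix form, v = F wbar F^-1, where wbar is the entrywise conjugate of w. *)
Definition conj_equiv v w : Prop := exists F F' : imx I I R[i],
  [/\ mulm F F' = idm _ I, mulm F' F = idm _ I &
    forall i j, v (i, j) = \sum_k \sum_l (F (i, k) * F' (l, j)) *: star (w (k, l))].

(** The last hypothesis says that the vector X is fixed by the tensor product of w and v.
    Multiplying by the adjoint of w moves w to the other side and gives X^T wbar = v X^T, so the
    transpose of X is the required F. *)
Lemma conj_equiv_fixed v w (X : imx I I R[i]) : unitarym (@star R A) w -> invertible X ->
  (forall i j, X (i, j) *: 1 = \sum_k \sum_l X (k, l) *: (w (i, k) * v (j, l))) ->
  conj_equiv v w.
Proof.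
move=> [_ uw] [Y [XY YX]] h.
have wE p k : \sum_i star (w (i, p)) * w (i, k) = (p == k)%:R.
  move/ffunP/(_ (p, k)): uw; rewrite mulmE idmE => <-.
  by apply: eq_bigr => i _; rewrite ffunE.
have h' p j : \sum_i X (i, j) *: star (w (i, p)) = \sum_l X (p, l) *: v (j, l).
  transitivity (\sum_i \sum_k \sum_l X (k, l) *: (star (w (i, p)) * w (i, k) * v (j, l))).
    apply: eq_bigr => i _; rewrite -[in LHS](mulr1 (star _)) scalerAr h mulr_sumr.
    apply: eq_bigr => k _; rewrite mulr_sumr; apply: eq_bigr => l _.
    by rewrite -scalerAr mulrA.
  transitivity (\sum_k \sum_l X (k, l) *: ((p == k)%:R * v (j, l))).
    rewrite exchange_big; apply: eq_bigr => k _; rewrite exchange_big.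
    by apply: eq_bigr => l _; rewrite -scaler_sumr -mulr_suml wE.
  rewrite (bigD1 p) //= [X in _ + X]big1 ?addr0 => [|k /negbTE kp].
    by apply: eq_bigr => l _; rewrite eqxx mul1r.
  by apply: big1 => l _; rewrite eq_sym kp mul0r scaler0.
exists [ffun ij => X (ij.2, ij.1)], [ffun ij => Y (ij.2, ij.1)]; split.
- apply/ffunP=> -[i j]; rewrite mulmE idmE.
  move/ffunP/(_ (j, i)): YX; rewrite mulmE idmE eq_sym => <-.
  by apply: eq_bigr => k _; rewrite !ffunE mulrC.
- apply/ffunP=> -[i j]; rewrite mulmE idmE.
  move/ffunP/(_ (j, i)): XY; rewrite mulmE idmE eq_sym => <-.
  by apply: eq_bigr => k _; rewrite !ffunE mulrC.
- move=> i j; transitivity (\sum_p Y (j, p) *: \sum_l X (p, l) *: v (i, l)).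
    transitivity (\sum_l mulm Y X (j, l) *: v (i, l)).
      rewrite YX (bigD1 j) //= idmE eqxx scale1r big1 ?addr0 // => l /negbTE lj.
      by rewrite idmE eq_sym lj scale0r.
    transitivity (\sum_l \sum_p (Y (j, p) * X (p, l)) *: v (i, l)).
      by apply: eq_bigr => l _; rewrite mulmE scaler_suml.
    rewrite exchange_big; apply: eq_bigr => p _; rewrite scaler_sumr.
    by apply: eq_bigr => l _; rewrite scalerA.
  rewrite exchange_big; apply: eq_bigr => p _; rewrite -h' scaler_sumr.
  by apply: eq_bigr => k _; rewrite !ffunE scalerA mulrC.
Qed.

(** Conjugating entrywise turns v = F wbar F^-1 into a product of w with two invertible scalar
    matrices. *)
Lemma conj_equiv_invertible v w : conj_equiv v w -> invertible w ->
  invertible (conjm (@star R A) v).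
Proof.
move=> [F [F' [FF' F'F vE]]] wi.
pose sc (G : imx I I R[i]) : imx I I A := [ffun ij => (G ij)^* *: 1].
have scM G G' : mulm G G' = idm _ I -> mulm (sc G) (sc G') = idm _ I.
  move=> GG; apply/ffunP=> -[i j]; rewrite mulmE idmE.
  move/ffunP/(_ (i, j)): GG; rewrite mulmE idmE.
  move=> /(congr1 (fun c : R[i] => c^* *: (1 : A))); rewrite conjC_nat scaler_nat => <-.
  rewrite rmorph_sum scaler_suml; apply: eq_bigr => k _.
  by rewrite !ffunE -scalerAl mul1r scalerA rmorphM.
suff -> : conjm (@star R A) v = mulm (mulm (sc F) w) (sc F').
  apply: invertible_mul; first apply: invertible_mul => //.
    by exists (sc F'); split; apply: scM.
  by exists (sc F); split; apply: scM.
apply/ffunP=> -[i j]; rewrite ffunE vE mulmE star_sum.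
under eq_bigr do rewrite star_sum; rewrite exchange_big /=.
apply: eq_bigr => l _; rewrite mulmE mulr_suml; apply: eq_bigr => k _.
rewrite starZ starK !ffunE -scalerAl mul1r -scalerAr mulr1 scalerA rmorphM.
by rewrite mulrC.
Qed.

End ConjugateEquivalence.

Section RigidConjugate.
Variables (R : realType) (A : cstarAlgType R) (I : finType) (u ub : imx I I A).
Variables (m : nat) (n : 'I_m -> nat) (C : forall x y : word, blocks m x y -> Prop).
Variable Q : imx I (multi_index n) R[i].
Hypotheses (hC : category C) (rC : rigid C) (gC : graded_category n C).
Hypothesis uQ : unitarym (fun c : R[i] => c^*) Q.
Hypotheses (uu : unitarym (@star R A) u) (uub : unitarym (@star R A) ub).
Hypothesis homC : forall x y (p : blocks m x y), C p ->
  hom (rep_power u ub x) (rep_power u ub y) (part_operator Q p).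

(** The conjugate equations with labels bounded by [n], as required for matrix entries. Gradedness
    carries the bound along blocks, and positivity of [n] makes 0 an admissible default. *)
Lemma rigid_snake : exists cup : forall c, blocks m [::] [:: c; flip_colour c],
  (forall c, C (cup c)) /\
  ((forall l, (0 < n l)%N) -> forall c (a b : multi_index n),
    (exists beta, [/\ forall l, (beta l < n l)%N,
      cup_rel (cup c) (fun l => a l) beta & cup_rel (cup (flip_colour c)) beta (fun l => b l)])
    <-> (fun l => a l : nat) =1 (fun l => b l : nat)).
Proof.
have [r [s [Cr Cs snW snB]]] := rC.
pose cup c : blocks m [::] [:: c; flip_colour c] :=
  match c with White => r | Black => s end.
exists cup; split=> [[]//|n0 c a b].
have gr x y (p : blocks m x y) : C p -> forall B (a b : point m x y) v,
    B \in p -> a \in B -> b \in B -> (v < n a.2)%N -> (v < n b.2)%N.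
  by move=> Cp B a' b' v pB Ba Bb; rewrite (gC Cp pB Ba Bb).
have tensC c' (t : blocks m [::] [:: c'; flip_colour c']) :
    C t -> C (part_tensor (part_inv t) (part_id m [:: c'])).
  move=> Ct; apply: (category_tensor hC (category_inv hC Ct)).
  exact: category_id.
have tensC' c' x (t : blocks m [::] x) : C t -> C (part_tensor (part_id m [:: c']) t).
  by move=> Ct; apply: (category_tensor hC _ Ct); exact: category_id.
have sid := @sat_id m [:: c] (fun _ l => b l : nat) (fun _ l => a l : nat).
transitivity (sat (part_id m [:: c]) (fun _ l => b l : nat) (fun _ l => a l : nat)); last first.
  rewrite sid; split=> [h l|h k l _]; first exact/esym/(h 0%N l isT).
  exact/esym/h.
apply: iff_sym; case: c {sid}.
- rewrite -snW; apply: (@sat_snake m (fun l v => (v < n l)%N) (fun _ => 0%N) White r s s);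
    by [|exact/gr/(tensC White)|exact/gr/(tensC' White)|move=> _ l; exact: ltn_ord].
- rewrite -snB; apply: (@sat_snake m (fun l v => (v < n l)%N) (fun _ => 0%N) Black s r r);
    by [|exact/gr/(tensC Black)|exact/gr/(tensC' Black)|move=> _ l; exact: ltn_ord].
Qed.

(** The cup of colour [c] is an intertwiner from the trivial representation, that is, a fixed vector
    of the form required by [conj_equiv_fixed]. *)
Lemma rigid_conj_equiv c :
  conj_equiv (colour_case u ub (flip_colour c)) (colour_case u ub c).
Proof.
(* Over an empty [I] there are no entries to compare. *)
have [i0 _|I0] := pickP (fun _ : I => true); last first.
  exists [ffun=> 0], [ffun=> 0].
  by split; [apply/ffunP|apply/ffunP|]; first [move=> [i j]|move=> i j]; have := I0 i.
(* A diagonal entry of the product of [Q] with its adjoint is 1, so the sum has a term: a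
   multi-index exists, and every [n l] is positive. *)
have n0 l : (0 < n l)%N.
  have [/ffunP/(_ (i0, i0)) + _] := uQ; rewrite mulmE idmE eqxx.
  case: (pickP (fun _ : multi_index n => true)) => [a _|M0].
    by rewrite (leq_ltn_trans _ (ltn_ord (a l))).
  by rewrite big_pred0 // => /esym/eqP; rewrite oner_eq0.
have [cup [Ccup /(_ n0) snake]] := rigid_snake.
apply: (conj_equiv_fixed (X := cup_op Q (cup c))).
- by case: (c).
- apply: (invertible_cup_op uQ (snake c)) => a b.
  by have := snake (flip_colour c) a b; rewrite flip_colourK.
- move=> i j; have := homC (Ccup c) (ffun2 i j : {ffun 'I_(size [:: c; flip_colour c]) -> I})
    (ffun0 (card_ord 0) : {ffun 'I_0 -> I}).
  rewrite (sum_ffun0 _ (ffun0 (card_ord 0) : {ffun 'I_0 -> I})) /rep_power.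
  rewrite [word_power _ _ _]ffunE big_ord0 (part_operator_cup Q (cup c)).
  rewrite (@sum_ffun2 _ I) {1 2}/ffun2 !ffunE /= => ->.
  apply: eq_bigr => k _; apply: eq_bigr => l _.
  by rewrite (part_operator_cup Q (cup c)) !/ffun2 !(ffunE, big_ord_recl, big_ord0) /= mulr1.
Qed.

End RigidConjugate.

(** * The quantum group of a power *)

Lemma mxprod_rev_comm (K : comPzRingType) n (I J : finType) (W : 'I_n -> imx I J K) :
  mxprod_rev W = mxprod W.
Proof.
apply/ffunP=> -[i j]; rewrite !ffunE /=.
by rewrite [RHS](reindex_inj rev_ord_inj).
Qed.

Section ConjEquivTheory.
Variables (R : realType) (A : cstarAlgType R).

Lemma conj_equiv_sym (I : finType) (v w : imx I I A) : conj_equiv v w -> conj_equiv w v.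
Proof.
move=> [F [F' [FF' F'F vE]]].
pose cj := fun c : R[i] => c^*.
have cjM (X Y : imx I I R[i]) : mulm X Y = idm _ I -> mulm (conjm cj X) (conjm cj Y) = idm _ I.
  move=> XY; apply/ffunP=> -[i j]; rewrite mulmE idmE.
  move/ffunP/(_ (i, j)): XY; rewrite mulmE idmE => /(congr1 cj).
  rewrite /cj conjC_nat rmorph_sum => <-; apply: eq_bigr => k _.
  by rewrite !ffunE rmorphM.
exists (conjm cj F'), (conjm cj F); split; [exact: cjM|exact: cjM|move=> i j].
have e (p q : I) : \sum_k \sum_l (F' (p, k) * F (l, q)) *: v (k, l) = star (w (p, q)).
  transitivity (\sum_k \sum_l \sum_a \sum_b
      (F' (p, k) * F (k, a) * (F' (b, l) * F (l, q))) *: star (w (a, b))).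
    apply: eq_bigr => k _; apply: eq_bigr => l _; rewrite vE scaler_sumr.
    apply: eq_bigr => a _; rewrite scaler_sumr; apply: eq_bigr => b _.
    by rewrite scalerA; congr (_ *: _); ring.
  transitivity (\sum_a \sum_b ((p == a)%:R * (b == q)%:R) *: star (w (a, b))).
    under eq_bigr do rewrite exchange_big.
    rewrite exchange_big /=; apply: eq_bigr => a _.
    under eq_bigr do rewrite exchange_big.
    rewrite exchange_big /=; apply: eq_bigr => b _.
    rewrite -!idmE -F'F !mulmE mulr_suml scaler_suml; apply: eq_bigr => k _.
    by rewrite mulr_sumr scaler_suml.
  rewrite (bigD1 p) //= [X in _ + X]big1 ?addr0 => [|a /negbTE ap].
    rewrite (bigD1 q) //= big1 ?addr0 => [|b /negbTE bq].
      by rewrite !eqxx mulr1 scale1r.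
    by rewrite bq mulr0 scale0r.
  by apply: big1 => b _; rewrite eq_sym ap mul0r scale0r.
rewrite -[LHS]starK -e star_sum; apply: eq_bigr => k _; rewrite star_sum.
by apply: eq_bigr => l _; rewrite starZ rmorphM !ffunE.
Qed.

Lemma unitarym_invertible (I : finType) (v : imx I I A) :
  unitarym (@star R A) v -> invertible v.
Proof. by move=> [h1 h2]; exists (adjm (@star R A) v). Qed.

(** The star reverses products, so the conjugate of an increasing product corresponds to a
    decreasing one. The scalar matrices commute entrywise, and their products can be taken in either
    order. *)
Lemma conj_equiv_mxprod n (I : finType) (V W : 'I_n -> imx I I A) :
  (forall k, conj_equiv (V k) (W k)) -> conj_equiv (mxprod_rev V) (mxprod W).
Proof.
move=> /fin_all_exists[F /fin_all_exists[F' h]].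
exists (mxprod F), (mxprod F'); split.
- by rewrite -[mxprod F']mxprod_rev_comm; apply: mxprod_mul_rev => k; have [] := h k.
- by rewrite -[mxprod F]mxprod_rev_comm; apply: mxprod_mul_rev => k; have [] := h k.
move=> i j; rewrite ffunE /=.
pose c (k : 'I_n) (ab : I * I) : R[i] := F k (i k, ab.1) * F' k (ab.2, j k).
transitivity (\prod_(k < n) \sum_(ab : I * I)
    c (rev_ord k) ab *: star (W (rev_ord k) (ab.1, ab.2))).
  apply: eq_bigr => k _; have [_ _ ->] := h (rev_ord k).
  by rewrite pair_big.
rewrite bigA_distr_bigA /= pair_big /=.
have bij : bijective (fun fg : {ffun 'I_n -> I} * {ffun 'I_n -> I} =>
    [ffun k => (fg.1 (rev_ord k), fg.2 (rev_ord k))] : {ffun 'I_n -> I * I}).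
  exists (fun f : {ffun 'I_n -> I * I} =>
    ([ffun k => (f (rev_ord k)).1], [ffun k => (f (rev_ord k)).2])) => [[f g]|f].
    by congr (_, _); apply/ffunP=> k; rewrite !ffunE /= rev_ordK.
  by apply/ffunP=> k; rewrite !ffunE /= rev_ordK -surjective_pairing.
rewrite (reindex _ (onW_bij _ bij)) /=; apply: eq_bigr => -[f g] _ /=.
rewrite scaler_prod; congr (_ *: _); last first.
  rewrite [mxprod W _]ffunE conj_prod ?star1 //=; last by move=> *; exact: starM.
  by apply: eq_bigr => k _; rewrite ffunE.
rewrite !ffunE -big_split /= [RHS](reindex_inj rev_ord_inj) /=.
by apply: eq_bigr => k _; rewrite /c ffunE.
Qed.

End ConjEquivTheory.

(** * Restriction of the comultiplication *)

Section Comultiplication.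
Variables (R : realType) (A : cstarAlgType R) (I : finType) (u : imx I I A).
Variable D : comultiplication u.

Definition comul_matrix (J : finType) (v : imx J J A) : Prop :=
  forall i j, comul D (v (i, j)) = \sum_k comul_tens D (v (i, k)) (v (k, j)).

Lemma comul_mxprod n (W : 'I_n -> imx I I A) :
  (forall k, comul_matrix (W k)) -> comul_matrix (mxprod W).
Proof.
move=> h i j; rewrite ffunE rmorph_prod /=; under eq_bigr do rewrite h.
rewrite bigA_distr_bigA; apply: eq_bigr => f _; rewrite !ffunE /=.

rewrite -[LHS]/(\prod_(k < n) comul_tens D (W k (i k, f k)) (W k (f k, j k))).
apply/esym; elim/big_rec3: _ => [|k a b c _ <-].
  exact: (spatial_tensor1 (comul_spatial D)).
exact/esym/(spatial_tensorM (comul_spatial D)).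
Qed.

Lemma comul_mxprod_rev n (W : 'I_n -> imx I I A) :
  (forall k, comul_matrix (W k)) -> comul_matrix (mxprod_rev W).
Proof.
move=> h i j; rewrite mxprod_revE (comul_mxprod (fun k => h _)).
rewrite (reindex_inj (can_inj (@ffun_revK n I))) /=.
by apply: eq_bigr => f _; rewrite !mxprod_revE.
Qed.

Variables (J : finType) (w : imx J J A).
Hypothesis comulw : comul_matrix w.

Let X : set A := range w.
Let W : set (comul_target D) :=
  [set s | exists a b, [/\ cstar_gen X a, cstar_gen X b & s = comul_tens D a b]].

(** On an entry of [w] the value is a sum of elementary tensors of entries; [cstar_closed_preimage]
    extends this to all that the entries generate. *)
Lemma comul_sub_subproof (a : cstar_sub X) : comul D (\val a) \in cstar_gen_pred W.
Proof.
apply: (introT (cstar_gen_predP _ _)).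
apply: (@cstar_sub_valP _ _ _ a (comul D @^-1` cstar_gen W)); split.
  apply: (@cstar_closed_preimage _ _ _ (comul D)); [exact: comul_star|exact: cstar_genP].
move=> _ [[i j] _ <-]; rewrite /preimage /= comulw.
apply: (elimT (cstar_gen_predP _ _)); apply: rpred_sum => k _.
apply: (introT (cstar_gen_predP _ _)); apply: sub_gen_smallest.
by exists (w (i, k)), (w (k, j)); split=> //; apply: sub_gen_smallest; exact: imageT.
Qed.

Definition comul_sub (a : cstar_sub X) : cstar_sub W := CStarSub (comul_sub_subproof a).

Let comul_sub_linear : linear comul_sub.
Proof. by move=> k a b; apply: val_inj; rewrite /= linearP. Qed.

HB.instance Definition _ := GRing.isLinear.Build _ _ _ _ comul_sub comul_sub_linear.

Let comul_sub_monoid : monoid_morphism comul_sub.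
Proof. by split=> [|a b]; apply: val_inj; rewrite /= ?rmorph1 ?rmorphM. Qed.

HB.instance Definition _ := GRing.isMonoidMorphism.Build _ _ comul_sub comul_sub_monoid.

Definition mx_sub : imx J J (cstar_sub X) := [ffun ij => CStarSub (gen_entry w ij)].

Lemma val_sum_sub (B : cstarAlgType R) (Y : set B) (K : finType) (F : K -> cstar_sub Y) :
  \val (\sum_k F k) = \sum_k \val (F k).
Proof. exact: raddf_sum. Qed.

(** Kept transparent, since later arguments compute with its projections. *)
Definition comultiplication_sub : comultiplication mx_sub.
Proof.
apply: (@Build_comultiplication _ _ _ mx_sub (cstar_sub W)
  (@tens_sub _ _ _ _ (comul_tens D) X X) (spatial_tensor_sub (comul_spatial D) X X)
  comul_sub).
- by move=> a; apply: val_inj; exact: comul_star.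
- move=> i j; apply: val_inj; rewrite val_sum_sub /= ffunE /= comulw.
  by apply: eq_bigr => k _; rewrite !ffunE.
Defined.

End Comultiplication.

Section SubMatrices.
Variables (R : realType) (A : cstarAlgType R) (X : set A).

Definition val_mx (I J : finType) (v : imx I J (cstar_sub X)) : imx I J A :=
  [ffun ij => \val (v ij)].

Lemma val_mx_inj I J : injective (@val_mx I J).
Proof.
move=> v w e; apply/ffunP=> ij; apply: val_inj.
by move/ffunP/(_ ij): e; rewrite !ffunE.
Qed.

Lemma val_mulm (I J K : finType) (v : imx I J (cstar_sub X)) (w : imx J K (cstar_sub X)) :
  val_mx (mulm v w) = mulm (val_mx v) (val_mx w).
Proof.
apply/ffunP=> -[i k]; rewrite ffunE !mulmE val_sum_sub.
by apply: eq_bigr => j _; rewrite !ffunE.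
Qed.

Lemma val_idm (I : finType) : val_mx (idm (cstar_sub X) I) = idm A I.
Proof. by apply/ffunP=> ij; rewrite !ffunE; case: (_ == _). Qed.

Lemma val_adjm (I J : finType) (v : imx I J (cstar_sub X)) :
  val_mx (adjm (@star R _) v) = adjm (@star R A) (val_mx v).
Proof. by apply/ffunP=> ij; rewrite !ffunE. Qed.

Lemma unitarym_sub (I J : finType) (v : imx I J (cstar_sub X)) :
  unitarym (@star R A) (val_mx v) -> unitarym (@star R _) v.
Proof.
by move=> [h1 h2]; split; apply: val_mx_inj; rewrite val_mulm val_adjm val_idm.
Qed.

Lemma conj_equiv_sub (I : finType) (v w : imx I I (cstar_sub X)) :
  conj_equiv (val_mx v) (val_mx w) -> conj_equiv v w.
Proof.
move=> [F [F' [h1 h2 vE]]]; exists F, F'; split=> // i j; apply: val_inj.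
have := vE i j; rewrite ffunE => ->; rewrite val_sum_sub; apply: eq_bigr => k _.
by rewrite val_sum_sub; apply: eq_bigr => l _; rewrite ffunE.
Qed.

End SubMatrices.

Section Power.
Variables (R : realType) (A : cstarAlgType R) (I : finType) (u ub : imx I I A).
Variable D : comultiplication u.
Hypotheses (uu : unitarym (@star R A) u) (repub : unitary_representation D ub).
Hypothesis conjU : forall c,
  conj_equiv (colour_case u ub (flip_colour c)) (colour_case u ub c).
Variable z : word.
Notation L := (size z).
Notation U := (colour_case u ub).
Notation w := (rep_power u ub z).
Notation J := {ffun 'I_L -> I}.

(** The power of u along [conj_word z], with its tensor legs listed in the order of [z]: the factors
    are multiplied in reverse, but rows and columns are indexed as those of u^z, as befits an
    operator on the conjugate space. *)
Definition conj_power : imx J J A :=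
  mxprod_rev (fun k : 'I_L => U (flip_colour (nth White z k))).

Lemma unitarym_letter c : unitarym (@star R A) (U c).
Proof. by case: c => //; have [] := repub. Qed.

Lemma comul_letter c : comul_matrix D (U c).
Proof. by case: c => i j; [exact: comul_fundamental|have [[_ ->]] := repub]. Qed.

Lemma rep_powerE : w = mxprod (fun k : 'I_L => U (nth White z k)).
Proof. by []. Qed.

Lemma conj_equiv_power : conj_equiv conj_power w.
Proof. by rewrite rep_powerE; apply: conj_equiv_mxprod => k. Qed.

Lemma conj_power_entry ij : conj_power ij \in cstar_gen_pred (range w).
Proof.
case: ij => i j; have [F [F' [_ _ ->]]] := conj_equiv_power.
apply: rpred_sum => k _; apply: rpred_sum => l _; apply: rpredZ.
exact: (cstar_sub_star (CStarSub (gen_entry w (k, l)))).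
Qed.

Definition conj_power_sub : imx J J (cstar_sub (range w)) :=
  [ffun ij => CStarSub (conj_power_entry ij)].

Lemma val_conj_power_sub : val_mx conj_power_sub = conj_power.
Proof. by apply/ffunP=> ij; rewrite !ffunE. Qed.

Lemma val_mx_sub : val_mx (mx_sub w) = w.
Proof. by apply/ffunP=> ij; rewrite /mx_sub !ffunE. Qed.

Lemma cstar_gen_mx_sub : cstar_gen (range (mx_sub w)) = setT.
Proof.
apply: cstar_sub_ind; first exact: cstar_genP.
move=> s [ij _ e]; apply: sub_gen_smallest; exists ij => //.
by apply: val_inj; rewrite ffunE.
Qed.

Lemma comul_rep_power : comul_matrix D w.
Proof. by rewrite rep_powerE; apply: comul_mxprod => k; exact: comul_letter. Qed.

Lemma unitarym_conj_power_sub : unitarym (@star R _) conj_power_sub.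
Proof.
apply: unitarym_sub; rewrite val_conj_power_sub.
by apply: unitarym_mxprod_rev => [||k]; [exact: star1|exact: starM|exact: unitarym_letter].
Qed.

Lemma compact_power : compact_matrix_quantum_group
  (MatrixPair (mx_sub w)).
Proof.
split=> /=.
- exact: cstar_gen_mx_sub.
- apply: unitarym_sub; rewrite val_mx_sub rep_powerE.
  by apply: unitarym_mxprod => [||k]; [exact: star1|exact: starM|exact: unitarym_letter].
(* Up to invertible scalar matrices the conjugate of u^z is [conj_power_sub], which is unitary. *)
- apply: (@conj_equiv_invertible _ _ _ _ conj_power_sub).
    apply/conj_equiv_sym/conj_equiv_sub; rewrite val_conj_power_sub val_mx_sub.
    exact: conj_equiv_power.
  exact/unitarym_invertible/unitarym_conj_power_sub.
- exact (inhabits (comultiplication_sub comul_rep_power)).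
Qed.

Lemma unitary_representation_conj_power :
  unitary_representation (comultiplication_sub comul_rep_power) conj_power_sub.
Proof.
split; last exact: unitarym_conj_power_sub.
split; first exact/unitarym_invertible/unitarym_conj_power_sub.
move=> i j; apply: val_inj; rewrite val_sum_sub /= ffunE /=.
rewrite (comul_mxprod_rev (fun k => comul_letter _)).
by apply: eq_bigr => k _; rewrite /= ![conj_power_sub _]ffunE.
Qed.

End Power.

(** * Intertwiners *)

Lemma prod_ord_mul (A : pzRingType) a b (F : nat -> A) :
  \prod_(s < a * b) F s = \prod_(k < a) \prod_(l < b) F (k * b + l)%N.
Proof.
elim: a => [|a IH]; first by rewrite !big_ord0.
rewrite [RHS]big_ord_recr -IH /= mulSn addnC big_split_ord /=.
by congr (_ * _).
Qed.

Section ExpandIndex.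
Variable z : word.
Notation L := (size z).

Definition expand_index x (I : Type) (i : {ffun 'I_(size x) -> {ffun 'I_L -> I}}) :
    {ffun 'I_(size (expand_word z x)) -> I} := [ffun s => i (fold_pos s).1 (fold_pos s).2].

Definition fold_index x (I : Type) (f : {ffun 'I_(size (expand_word z x)) -> I}) :
    {ffun 'I_(size x) -> {ffun 'I_L -> I}} := [ffun k => [ffun a => f (unfold_pos (k, a))]].

Lemma expand_indexE x I (i : {ffun 'I_(size x) -> {ffun 'I_L -> I}}) k a :
  expand_index i (unfold_pos (k, a)) = i k a.
Proof. by rewrite ffunE unfold_posK. Qed.

Lemma expand_indexK x I : cancel (@expand_index x I) (@fold_index x I).
Proof. by move=> i; apply/ffunP=> k; apply/ffunP=> a; rewrite !ffunE unfold_posK. Qed.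

Lemma fold_indexK x I : cancel (@fold_index x I) (@expand_index x I).
Proof. by move=> f; apply/ffunP=> s; rewrite !ffunE -surjective_pairing fold_posK. Qed.

(* The conjugate of a tensor product is the product of the conjugates in the
   reverse order. *)
Definition power_letter (A : pzRingType) (I J : finType) (W : colour -> imx I J A)
    (c : colour) : imx {ffun 'I_L -> I} {ffun 'I_L -> J} A :=
  colour_case (mxprod (fun k : 'I_L => W (nth White z k)))
    (mxprod_rev (fun k : 'I_L => W (flip_colour (nth White z k)))) c.

(** The product over positions of the expanded word is cut into consecutive factors of length [L],
    one for each letter of [x]. *)
Lemma word_power_expand (A : pzRingType) (I J : finType) (W : colour -> imx I J A) x i j :
  word_power W (expand_word z x) (expand_index i, expand_index j)
  = word_power (power_letter W) x (i, j).
Proof.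
rewrite !ffunE /=.
pose G s := W (nth White (expand_word z x) s).
(* A total function of the position, as [prod_ord_mul] demands; the default 1 lies outside the range
   of the product. *)
pose F s : A := if insub s is Some s' then G s (expand_index i s', expand_index j s') else 1.
transitivity (\prod_(s < size x * L) F s).
  rewrite -size_expand; apply: eq_bigr => s _; rewrite /F valK //.
rewrite prod_ord_mul; apply: eq_bigr => k _.
have FE (a : 'I_L) : F (k * L + letter_pos L (nth White x k) a)%N
    = colour_case (W (nth White z a)) (W (flip_colour (nth White z a)))
        (nth White x k) (i k a, j k a).
  rewrite -[(_ + _)%N]/(val (unfold_pos (k, a))) /F valK !expand_indexE /G /=.
  by rewrite nth_expand //; case: (nth _ x k).
case: (nth White x k) FE => FE; rewrite /= ffunE /=.
  by apply: eq_bigr => a _; exact: FE.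
(* In a black copy, position [a] holds letter [rev_ord a] of [z], which is the order of
   [mxprod_rev]. *)
apply: eq_bigr => a _; rewrite -[RHS](FE (rev_ord a)) /letter_pos /=; congr (F _).
by have := ltn_ord a; lia.
Qed.

End ExpandIndex.

Section FoldMultiIndex.
Variables (z : word) (m : nat) (n : 'I_m -> nat).
Notation L := (size z).
Notation m' := (fold_levels z m).

Definition fold_dim (l : 'I_m') : nat := n (enum_val l).2.
Notation n' := fold_dim.

Lemma fold_dimE a l : n' (enum_rank (a, l)) = n l.
Proof. by rewrite /n' enum_rankK. Qed.

Definition split_index (j : multi_index n') : {ffun 'I_L -> multi_index n} :=
  [ffun a => [ffun l => cast_ord (fold_dimE a l) (j (enum_rank (a, l)))] : multi_index n].

Definition merge_index (f : {ffun 'I_L -> multi_index n}) : multi_index n' :=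
  [ffun l => f (enum_val l).1 (enum_val l).2].

(** The entries at [l] and [l'] lie in different types, so they are compared as natural numbers. *)
Lemma multi_index_congr k (d : 'I_k -> nat) (j : multi_index d) l l' :
  l = l' -> j l = j l' :> nat.
Proof. by move->. Qed.

Lemma split_indexE j a l : split_index j a l = j (enum_rank (a, l)) :> nat.
Proof. by rewrite !ffunE. Qed.

Lemma split_indexK : cancel split_index merge_index.
Proof.
move=> j; apply/ffunP=> l; apply: val_inj; rewrite ffunE /= split_indexE.
by apply: multi_index_congr; rewrite -surjective_pairing enum_valK.
Qed.

Lemma merge_indexK : cancel merge_index split_index.
Proof.
move=> f; apply/ffunP=> a; apply/ffunP=> l; apply: val_inj.
rewrite /= split_indexE ffunE.
have e p q : p = q -> f p.1 p.2 = f q.1 q.2 :> nat by move->.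
exact: e _ (a, l) (enum_rankK _).
Qed.

Definition expand_labels x (g : {ffun 'I_(size x) -> multi_index n'}) :
    {ffun 'I_(size (expand_word z x)) -> multi_index n} :=
  expand_index [ffun k => split_index (g k)].

Lemma expand_labels_bij x : bijective (@expand_labels x).
Proof.
exists (fun f => [ffun k => merge_index (fold_index f k)]) => [g|f].
  by apply/ffunP=> k; rewrite ffunE expand_indexK ffunE split_indexK.
rewrite /expand_labels -[RHS]fold_indexK; congr expand_index.
by apply/ffunP=> k; rewrite !ffunE merge_indexK; apply/ffunP=> a; rewrite !ffunE.
Qed.

Lemma part_matrix_unfold (K : pzRingType) x y (p : blocks m' x y) g h :
  part_matrix K n' p (g, h) = part_matrix K n (unfold p) (expand_labels g, expand_labels h).
Proof.
apply: eq_part_matrix; rewrite constant_on_unfold; apply: eq_constant_on => a.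
case: a => -[k|k] l; rewrite /point_label /=; rewrite expand_indexE ffunE split_indexE;
  by apply: multi_index_congr; rewrite -surjective_pairing enum_valK.
Qed.

Variables (R : realType) (I : finType) (Q : imx I (multi_index n) R[i]).
Notation cj := (fun c : R[i] => c^*).

(** The tensor power of Q along [z], with the conjugate of Q at black letters, preceded by the
    identification of the new multi-indices with words of old ones. *)
Definition fold_unitary : imx {ffun 'I_L -> I} (multi_index n') R[i] :=
  [ffun ij => mxprod (fun k : 'I_L => colour_mx Q (nth White z k)) (ij.1, split_index ij.2)].
Notation Q' := fold_unitary.

Lemma unitarym_fold : unitarym cj Q -> unitarym cj Q'.
Proof.
move=> uQ; have [U1 U2] : unitarym cj (mxprod (fun k : 'I_L => colour_mx Q (nth White z k))).
  apply: unitarym_mxprod => [||k]; [exact: conjC1| |exact: unitarym_colour].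
  by move=> a b; rewrite rmorphM mulrC.
split; apply/ffunP=> -[i j]; rewrite mulmE idmE.
  move/ffunP/(_ (i, j)): U1; rewrite mulmE idmE => <-.
  rewrite [RHS](reindex _ (onW_bij _ (Bijective split_indexK merge_indexK))).
  by apply: eq_bigr => f _; rewrite ![Q' _]ffunE ![adjm _ _ _]ffunE ![Q' _]ffunE.
move/ffunP/(_ (split_index i, split_index j)): U2.
rewrite mulmE idmE (can_eq split_indexK) => <-.
by apply: eq_bigr => f _; rewrite ![Q' _]ffunE ![adjm _ _ _]ffunE ![Q' _]ffunE.
Qed.

(** Over commuting scalars the order of the factors is irrelevant, so the black letter gives the
    entrywise conjugate of the white one. This matches the colours of [fold_unitary]. *)
Lemma power_letter_comm (J1 J2 : finType) (V : colour -> imx J1 J2 R[i]) i j c :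
  (forall c i j, V (flip_colour c) (i, j) = (V c (i, j))^*) ->
  power_letter z V c (i, j)
  = colour_case (mxprod (fun k : 'I_L => V (nth White z k)) (i, j))
      (mxprod (fun k : 'I_L => V (nth White z k)) (i, j))^* c.
Proof.
move=> Vf; case: c => //=; rewrite mxprod_rev_comm !ffunE rmorph_prod /=.
by apply: eq_bigr => k _.
Qed.

Lemma word_power_fold_unitary y i g :
  word_power (colour_case Q' (conjm cj Q')) y (i, g)
  = word_power (colour_case Q (conjm cj Q)) (expand_word z y) (expand_index i, expand_labels g).
Proof.
rewrite word_power_expand !ffunE /=; apply: eq_bigr => k _.
rewrite power_letter_comm; last by move=> c a b; rewrite -/(colour_mx Q _) colour_mx_flip.
have e a b : mxprod (fun k : 'I_L => colour_mx Q (nth White z k)) (a, split_index b)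
    = Q' (a, b) by rewrite [RHS]ffunE.
rewrite (ffunE (fun k => split_index (g k)) k) e.
by case: (nth White y k); rewrite /= ?[conjm _ _ _]ffunE.
Qed.

Lemma word_power_fold_adj x g i :
  word_power (colour_case (adjm cj Q') (conjm cj (adjm cj Q'))) x (g, i)
  = word_power (colour_case (adjm cj Q) (conjm cj (adjm cj Q))) (expand_word z x)
      (expand_labels g, expand_index i).
Proof.
rewrite word_power_expand !ffunE /=; apply: eq_bigr => k _.
rewrite power_letter_comm; last first.
  by move=> c a b; rewrite !adjm_colour !ffunE colour_mx_flip.
have e a b : mxprod (fun k : 'I_L => colour_case (adjm cj Q) (conjm cj (adjm cj Q))
    (nth White z k)) (split_index a, b) = (Q' (b, a))^*.
  rewrite !ffunE rmorph_prod /=; apply: eq_bigr => s _.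
  by rewrite adjm_colour ffunE.
rewrite (ffunE (fun k => split_index (g k)) k) e.
by case: (nth White x k); rewrite /= ?[conjm _ _ _]ffunE [adjm _ _ _]ffunE.
Qed.

(** Both inner sums are reindexed along [expand_labels_bij]; after that the three factors agree
    entry by entry. *)
Lemma part_operator_unfold x y (p : blocks m' x y) i j :
  part_operator Q' p (i, j) = part_operator Q (unfold p) (expand_index i, expand_index j).
Proof.
rewrite /part_operator !mulmE [RHS](reindex _ (onW_bij _ (expand_labels_bij x))).
apply: eq_bigr => h _; rewrite word_power_fold_adj; congr (_ * _).
rewrite !mulmE [RHS](reindex _ (onW_bij _ (expand_labels_bij y))).
by apply: eq_bigr => g _; rewrite word_power_fold_unitary part_matrix_unfold.
Qed.

End FoldMultiIndex.

Lemma ffun_linearE (K : pzRingType) (T : finType) (k : K) (f g : {ffun T -> K^o}) t :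
  (k *: f + g) t = k * f t + g t.
Proof. by rewrite !ffunE. Qed.

(** * Intertwiner spaces of the power *)

Section FoldHom.
Variables (R : realType) (A : cstarAlgType R) (I : finType) (u ub : imx I I A).
Variable D : comultiplication u.
Hypotheses (uu : unitarym (@star R A) u) (repub : unitary_representation D ub).
Hypothesis conjU : forall c,
  conj_equiv (colour_case u ub (flip_colour c)) (colour_case u ub c).
Variable z : word.
Notation L := (size z).
Notation U := (colour_case u ub).
Notation w := (rep_power u ub z).
Notation J := {ffun 'I_L -> I}.
Notation w' := (mx_sub w).
Notation ub' := (conj_power_sub conjU z).

Lemma val_prod_sub (Y : set A) n (F : 'I_n -> cstar_sub Y) :
  \val (\prod_(k < n) F k) = \prod_(k < n) \val (F k).
Proof. exact: rmorph_prod. Qed.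

Lemma val_rep_power_sub x i j : \val (rep_power w' ub' x (i, j))
  = rep_power u ub (expand_word z x) (expand_index i, expand_index j).
Proof.
rewrite /rep_power word_power_expand !ffunE val_prod_sub; apply: eq_bigr => k _ /=.
by case: (nth White x k); rewrite /= ffunE /= ?rep_powerE.
Qed.

Definition fold_op x y (T : imx {ffun 'I_(size (expand_word z y)) -> I}
    {ffun 'I_(size (expand_word z x)) -> I} R[i]) :
    imx {ffun 'I_(size y) -> J} {ffun 'I_(size x) -> J} R[i] :=
  [ffun ij => T (expand_index ij.1, expand_index ij.2)].

Definition expand_op x y (T : imx {ffun 'I_(size y) -> J} {ffun 'I_(size x) -> J} R[i]) :
    imx {ffun 'I_(size (expand_word z y)) -> I} {ffun 'I_(size (expand_word z x)) -> I} R[i] :=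
  [ffun ij => T (fold_index ij.1, fold_index ij.2)].

Lemma fold_opE x y T i j :
  @fold_op x y T (i, j) = T (expand_index i, expand_index j).
Proof. by rewrite ffunE. Qed.

Lemma expand_opE x y T i j : @expand_op x y T (i, j) = T (fold_index i, fold_index j).
Proof. by rewrite ffunE. Qed.

Lemma expand_opK x y : cancel (@expand_op x y) (@fold_op x y).
Proof. by move=> T; apply/ffunP=> -[i j]; rewrite !ffunE /= !expand_indexK. Qed.

(** By [val_rep_power_sub] the two sides are the same system of equations in [A], with indices
    renamed along a bijection. *)
Lemma hom_fold x y T :
  hom (rep_power u ub (expand_word z x)) (rep_power u ub (expand_word z y)) T <->
  hom (rep_power w' ub' x) (rep_power w' ub' y) (fold_op T).
Proof.
have bij v := onW_bij predT (Bijective (@expand_indexK z v I) (@fold_indexK z v I)).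
have e1 j i : \val (\sum_k fold_op T (j, k) *: rep_power w' ub' x (k, i)) =
    \sum_k T (expand_index j, k) *: rep_power u ub (expand_word z x) (k, expand_index i).
  rewrite val_sum_sub [RHS](reindex _ (bij x)); apply: eq_bigr => k _.
  by rewrite ffunE -val_rep_power_sub.
have e2 j i : \val (\sum_k fold_op T (k, i) *: rep_power w' ub' y (j, k)) =
    \sum_k T (k, expand_index i) *: rep_power u ub (expand_word z y) (expand_index j, k).
  rewrite val_sum_sub [RHS](reindex _ (bij y)); apply: eq_bigr => k _.
  by rewrite ffunE -val_rep_power_sub.
split=> h j i; first by apply: val_inj; rewrite e1 e2; exact: h.
by rewrite -(fold_indexK j) -(fold_indexK i) -e1 -e2 h.
Qed.

Variables (m : nat) (n : 'I_m -> nat) (C : forall x y : word, blocks m x y -> Prop).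
Variable Q : imx I (multi_index n) R[i].
Hypothesis hC : category C.
Hypothesis homE : forall x y,
  hom (rep_power u ub x) (rep_power u ub y)
  = lin_span [set T | exists2 p, @C x y p & T = part_operator Q p].

Lemma hom_fold_span x y :
  hom (rep_power w' ub' x) (rep_power w' ub' y)
  = lin_span [set T | exists2 p, @fold_category z m C x y p &
                      T = part_operator (fold_unitary z Q) p].
Proof.
apply/seteqP; split=> T.
  rewrite -[T]expand_opK => /hom_fold; rewrite homE.
  apply: (@lin_span_ind _ _ _ (fun T => lin_span _ (fold_op T))) => [|k S S' [p Cp ->] hS'].
    have -> : fold_op 0 = 0 :> imx {ffun 'I_(size y) -> J} {ffun 'I_(size x) -> J} R[i]^o.
      by apply/ffunP=> ij; rewrite !ffunE.
    exact: lin_span0.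
  have -> : fold_op (k *: part_operator Q p + S') =
      k *: part_operator (fold_unitary z Q) (fold p) + fold_op S'
      :> imx {ffun 'I_(size y) -> J} {ffun 'I_(size x) -> J} R[i]^o.
    apply/ffunP=> -[i j]; rewrite fold_opE !ffun_linearE fold_opE.
    by rewrite part_operator_unfold foldK.
  apply: lin_spanZD => //; exists (fold p) => //.
  split; last by rewrite foldK.
  exact/fold_partition/(category_partition hC Cp).
move=> hT; rewrite -[T]expand_opK; apply/hom_fold; rewrite homE.
apply: (@lin_span_ind _ _ _ (fun T => lin_span _ (expand_op T))) hT => [|k S S' [p Cp ->] hS'].
  have -> : expand_op 0 = 0 :> imx {ffun 'I_(size (expand_word z y)) -> I}
      {ffun 'I_(size (expand_word z x)) -> I} R[i]^o.
    by apply/ffunP=> ij; rewrite !ffunE.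
  exact: lin_span0.
have -> : expand_op (k *: part_operator (fold_unitary z Q) p + S') =
    k *: part_operator Q (unfold p) + expand_op S'
    :> imx {ffun 'I_(size (expand_word z y)) -> I} {ffun 'I_(size (expand_word z x)) -> I} R[i]^o.
  apply/ffunP=> -[i j]; rewrite expand_opE !ffun_linearE expand_opE.
  by rewrite part_operator_unfold !fold_indexK.
by apply: lin_spanZD => //; exists (unfold p) => //; case: Cp.
Qed.

End FoldHom.

Theorem corollary5p8 (R : realType) (G : matrix_pair R)
    (ublack : imx (basis_index G) (basis_index G) (function_algebra G)) (z : word) :
  spatial_partition_quantum_group_with ublack ->
  (0 < size z)%N ->
  spatial_partition_quantum_group (quantum_group_power ublack z).
Proof.
move=> [[_ uu _ _] [D [repub [m [n [C [Q [m0 [hC rC gC uQ homE]]]]]]]]] z0.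
have homC x y (p : blocks m x y) : C x y p ->
    hom (rep_power (fundamental G) ublack x) (rep_power (fundamental G) ublack y)
      (part_operator Q p).
  by move=> Cp; rewrite homE; apply: sub_lin_span; exists p.
have conjU := rigid_conj_equiv hC rC gC uQ uu repub.2 homC.
exists (conj_power_sub conjU z); split; first exact: (compact_power uu repub conjU).
exists (comultiplication_sub (comul_rep_power repub (z := z))); split.
  exact: unitary_representation_conj_power.
exists (fold_levels z m), (@fold_dim z m n), (@fold_category z m C), (fold_unitary z Q).
split; first by rewrite /fold_levels card_prod !card_ord muln_gt0 z0 m0.
split.
- exact: fold_categoryP.
- exact: fold_category_rigid.
- exact: fold_category_graded.
- exact: unitarym_fold.
- exact: hom_fold_span.
Qed.
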